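(* Let $G=(V,\vec E,b)$ be an infinite directed weighted graph with vertex measure $m$ satisfying the standing assumptions listed in the context (including Assumption $(\beta)$), let $\{G_n=(V_n,\vec E_n)\}_{n\in\mathbb N}$ be a filtration of $G$, and let $\overline\Delta$ be the closure in $\ell^2(V,m)$ of the Laplacian $\Delta$ defined on $\mathcal C_c(V)$. Put $\eta^{ess}(\overline\Delta)=\inf\{\mathrm{Re}\,\lambda:\lambda\in\sigma_{ess}(\overline\Delta)\}$. Then $$\frac{h_\infty^2}{8}\;\le\; M_\infty\,\eta^{ess}(\overline\Delta)\qquad\text{and}\qquad m_\infty\,\frac{\tilde h_\infty^2}{8}\;\le\;\eta^{ess}(\overline\Delta).$$
   Context: A directed weighted graph is $G=(V,\vec E,b)$ with $V$ a countable vertex set and $b:V\times V\to[0,\infty)$ satisfying $b(x,x)=0$ for all $x$ and $b(x,y)>0$ iff $(x,y)\in\vec E$; it carries a measure $m:V\to(0,\infty)$. Put $\beta^+(x)=\sum_{y\in V}b(x,y)$ and $\beta^-(x)=\sum_{y\in V}b(y,x)$. Standing assumptions: $G$ is locally finite (each $x$ has only finitely many $y$ with $b(x,y)>0$ or $b(y,x)>0$); $\beta^+(x)>0$ and $\beta^-(x)>0$ for all $x$; Assumption $(\beta)$: $\beta^+(x)=\beta^-(x)$ for all $x\in V$; $G$ is connected, i.e. any two distinct vertices are related by a path, in one of the two directions (a path from $x$ to $y$ is a finite sequence of directed edges $(x_1,y_1),\dots,(x_n,y_n)\in\vec E$, $n\ge2$, with $x_1=x$, $y_n=y$, $x_i=y_{i-1}$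 for $2\le i\le n$). $\mathcal C_c(V)$ is the space of finitely supported functions $V\to\mathbb C$; $\ell^2(V,m)$ has inner product $(f,g)_m=\sum_x m(x)f(x)\overline{g(x)}$. The Laplacian on $\mathcal C_c(V)$ is $\Delta f(x)=\frac1{m(x)}\sum_{y}b(x,y)(f(x)-f(y))$. It is closable; its closure $\overline\Delta$ has domain the set of $f\in\ell^2(V,m)$ for which there are $f_n\in\mathcal C_c(V)$ with $f_n\to f$ and $\Delta f_n$ convergent in $\ell^2(V,m)$, and $\overline\Delta f=\lim\Delta f_n$. The essential spectrum $\sigma_{ess}(A)$ of a closed operator $A$ is the set of $\lambda\in\mathbb C$ such that the range of $A-\lambda$ is not closed or $\dim\ker(A-\lambda)=\infty$. $\inf\emptyset=+\infty$. For $\Omega\subset V$ non-empty: $m_\Omega=\inf_{x\in\Omega}\beta^+(x)/m(x)$, $M_\Omega=\sup_{x\in\Omega}\beta^+(x)/m(x)$, $$h(\Omega)=\inf_U\frac{b(\partial_EU)}{m(U)},\qquad \tilde h(\Omega)=\inf_U\frac{b(\partial_EU)}{\beta^+(U)},$$ infima over non-empty finite $U\subset\Omega$, where $\partial_E U=\{(x,y)\in\vec E: (x\in U,y\in U^c)\text{ or }(x\in U^c,y\in U)\}$, $b(\partial_EU)=\sum_{(x,y)\in\partial_EU}b(x,y)$, $m(U)=\sum_{x\in U}m(x)$, $\beta^+(U)=\sum_{x\in U}\beta^+(x)$. A subgraph of $G$ is given by a subset $V_H\subset V$ of vertices with edge set $\vec E\cap(V_H\times V_H)$. A filtration of $G$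 is a sequence of finite connected subgraphs $G_n=(V_n,\vec E_n)$ with $G_n\subset G_{n+1}$ and $\bigcup_n V_n=V$. Then (monotone limits in $[0,\infty]$) $$m_\infty=\lim_n m_{V_n^c},\quad M_\infty=\lim_n M_{V_n^c},\quad h_\infty=\lim_n h(V_n^c),\quad \tilde h_\infty=\lim_n\tilde h(V_n^c).$$ Conventions: if $M_\infty=\infty$, the product $M_\infty\,\eta^{ess}(\overline\Delta)$ is read as $\infty$; $m_\infty\cdot 0=0$ even if $m_\infty=\infty$. *)

(* Defs.v *)
From HB Require Import structures.
From mathcomp Require Import all_boot all_order all_algebra.
From mathcomp Require Import all_classical all_reals all_analysis.
From mathcomp Require Import complex.

Set Implicit Arguments.
Unset Strict Implicit.
Unset Printing Implicit Defensive.

Import Order.TTheory GRing.Theory Num.Theory.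
Import numFieldNormedType.Exports.

Local Open Scope classical_set_scope.
Local Open Scope ring_scope.
Local Open Scope complex_scope.

Record wdigraph (R : realType) (V : countType) := WDigraph {
  edge : set (V * V);
  weight : V -> V -> R;
  weight_ge0 : forall x y, 0 <= weight x y;
  weight_diag : forall x, weight x x = 0;
  weight_gt0 : forall x y, 0 < weight x y <-> edge (x, y)
}.

Section Graph.
Variables (R : realType) (V : countType) (G : wdigraph R V).
Local Notation b := (weight G).

Definition locally_finite :=
  forall x, finite_set [set y | 0 < b x y \/ 0 < b y x].

(* [\sum_(y \in _)] adds up the nonzero terms when they are finitely many, and
   is 0 otherwise; the sums below are the intended ones as soon as [G] is
   locally finite (and [U] finite). *)
Definition beta_out (x : V) : R := \sum_(y \in [set: V]) b x y.
Definition beta_in (x : V) : R := \sum_(y \in [set: V]) b y x.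

(* A path has at least two edges. *)
Definition has_path (E : set (V * V)) (x y : V) :=
  exists (n : nat) (e : nat -> V * V),
    [/\ (2 <= n)%N,
        (forall i, (i < n)%N -> E (e i)),
        (e 0%N).1 = x, (e n.-1).2 = y &
        forall i, (i.+1 < n)%N -> (e i.+1).1 = (e i).2].

Definition sub_edge (W : set V) : set (V * V) := edge G `&` (W `*` W).

Definition connected_sub (W : set V) :=
  forall x y, W x -> W y -> x != y ->
    has_path (sub_edge W) x y \/ has_path (sub_edge W) y x.

Definition connected_graph :=
  forall x y : V, x != y -> has_path (edge G) x y \/ has_path (edge G) y x.

Definition filtration (Vn : nat -> set V) :=
  [/\ (forall n, finite_set (Vn n)),
      (forall n, connected_sub (Vn n)),
      (forall n, Vn n `<=` Vn n.+1) &
      \bigcup_n Vn n = [set: V]].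

Definition edge_boundary (U : set V) : set (V * V) :=
  [set e | edge G e /\ ((U e.1 /\ ~ U e.2) \/ (~ U e.1 /\ U e.2))].

Definition weight_boundary (U : set V) : R :=
  \sum_(e \in edge_boundary U) b e.1 e.2.

Variable m : V -> R.

Definition m_inf (Om : set V) : \bar R :=
  ereal_inf [set (beta_out x / m x)%:E | x in Om].

Definition M_sup (Om : set V) : \bar R :=
  ereal_sup [set (beta_out x / m x)%:E | x in Om].

Definition finite_parts (Om : set V) : set (set V) :=
  [set U | [/\ finite_set U, U !=set0 & U `<=` Om]].

Definition cheeger (Om : set V) : \bar R :=
  ereal_inf [set (weight_boundary U / \sum_(x \in U) m x)%:E
            | U in finite_parts Om].

Definition cheeger_tilde (Om : set V) : \bar R :=
  ereal_inf [set (weight_boundary U / \sum_(x \in U) beta_out x)%:E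
            | U in finite_parts Om].

Variable Vn : nat -> set V.

Definition m_infty : \bar R := limn (fun n => m_inf (~` Vn n)).
Definition M_infty : \bar R := limn (fun n => M_sup (~` Vn n)).
Definition h_infty : \bar R := limn (fun n => cheeger (~` Vn n)).
Definition h_tilde_infty : \bar R := limn (fun n => cheeger_tilde (~` Vn n)).

End Graph.

Section Operators.
Variables (R : realType) (V : countType) (m : V -> R).

(* [+oo] when [f] is not in l^2(V, m). *)
Definition l2norm (f : V -> R[i]) : \bar R :=
  sqrte (\esum_(x in [set: V]) (m x * ComplexField.Normc.normc (f x) ^+ 2)%:E).

Definition l2 : set (V -> R[i]) := [set f | (l2norm f < +oo)%E].

Definition l2cvg (u : nat -> V -> R[i]) (f : V -> R[i]) :=
  (fun n => l2norm (fun x => u n x - f x)) @ \oo --> 0%E.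

Definition l2closed (S : set (V -> R[i])) :=
  forall g, l2 g ->
    (forall e : R, 0 < e ->
       exists2 f, S f & (l2norm (fun x => (f x - g x)%R) < e%:E)%E) ->
    S g.

Definition infinite_dim (K : set (V -> R[i])) :=
  forall n : nat, exists f : 'I_n -> V -> R[i],
    (forall i, K (f i)) /\
    forall c : 'I_n -> R[i],
      (forall x, \sum_i c i * f i x = 0) -> forall i, c i = 0.

Record operator := Operator {
  op_dom : set (V -> R[i]);
  op_app : (V -> R[i]) -> V -> R[i]
}.

Definition range_sub (A : operator) (lam : R[i]) : set (V -> R[i]) :=
  [set (fun x => op_app A f x - lam * f x) | f in op_dom A].

Definition ker_sub (A : operator) (lam : R[i]) : set (V -> R[i]) :=
  [set f | op_dom A f /\ forall x, op_app A f x - lam * f x = 0].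

Definition ess_spectrum (A : operator) : set R[i] :=
  [set lam | ~ l2closed (range_sub A lam) \/ infinite_dim (ker_sub A lam)].

Definition eta_ess (A : operator) : \bar R :=
  ereal_inf [set (complex.Re lam)%:E | lam in ess_spectrum A].

Definition Cc : set (V -> R[i]) := [set f | finite_set [set x | f x != 0]].

(* [xget] picks the limit [g], which is unique when [A] is closable. *)
Definition operator_closure (A : operator) : operator :=
  let clos (f g : V -> R[i]) :=
    [/\ l2 f, l2 g &
        exists u : nat -> V -> R[i],
          [/\ (forall n, op_dom A (u n)), l2cvg u f &
              l2cvg (fun n => op_app A (u n)) g]] in
  Operator [set f | exists g, clos f g]
           (fun f => xget (fun=> 0) [set g | clos f g]).

Variable G : wdigraph R V.

Definition laplacian : operator :=
  Operator Cc
    (fun f x => ((m x)^-1)%:C *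
                \sum_(y \in [set: V]) (weight G x y)%:C * (f x - f y)).

End Operators.

(* Main.v *)
Require Import Defs.
From HB Require Import structures.
From mathcomp Require Import all_boot all_order all_algebra.
From mathcomp Require Import all_classical all_reals all_analysis.
From mathcomp Require Import complex finmap ring lra.

(* A number [lam] lies outside the essential spectrum as soon as the form
   Re(Delta f, f) dominates c |f|^2, for some c > Re lam, on the functions
   supported off a finite set W.  Cutting off a finitely supported function at
   W gives the estimate |f|^2 <= C (|(Delta - lam) f|^2 + max_W |f|^2), which
   passes to the closure; it forces the kernel to have dimension at most |W|
   and the range to be closed.  The lower bound on the form is Cheeger's
   inequality.  Since beta^+ = beta^-,
   2 Re(Delta f, f) = sum b(x,y) |f(x) - f(y)|^2; the co-area formula bounds
   sum b(x,y) |u(x)^2 - u(y)^2| from below by h sum mu u^2, and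
   Cauchy-Schwarz bounds it from above by the square root of
   8 (Delta u, u) (sum beta u^2).  Taking mu = m or mu = beta^+ gives
   the two inequalities, by letting W run through the filtration. *)

Set Implicit Arguments.
Unset Strict Implicit.
Unset Printing Implicit Defensive.

Import Order.TTheory GRing.Theory Num.Theory.
Import numFieldNormedType.Exports.

Local Open Scope classical_set_scope.
Local Open Scope ring_scope.
Local Open Scope complex_scope.

(** * Squared moduli of complex numbers *)

Section Modulus.
Variable R : rcfType.
Implicit Types z w : R[i].

(** Real-valued and free of square roots, so that the norm estimates become polynomial inequalities
    over [R]; the price is the factor 2 in [sqnD]. *)
Definition sqn z : R := complex.Re z ^+ 2 + complex.Im z ^+ 2.

Lemma normc_sqn z : ComplexField.Normc.normc z ^+ 2 = sqn z.
Proof. by case: z => a b; rewrite /= sqr_sqrtr // addr_ge0 ?sqr_ge0. Qed.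

Lemma sqn_ge0 z : 0 <= sqn z.
Proof. by rewrite addr_ge0 ?sqr_ge0. Qed.

Lemma sqn0 : sqn 0 = 0.
Proof. by rewrite /sqn /= expr0n /= addr0. Qed.

Lemma sqn_eq0 z : (sqn z == 0) = (z == 0).
Proof.
case: z => a b; rewrite /sqn /= paddr_eq0 ?sqr_ge0 // !sqrf_eq0.
by rewrite eq_complex.
Qed.

Lemma sqnN z : sqn (- z) = sqn z.
Proof. by case: z => a b; rewrite /sqn /= !sqrrN. Qed.

Lemma sqnB z w : sqn (z - w) = sqn (w - z).
Proof. by rewrite -opprB sqnN. Qed.

Lemma sqnM z w : sqn (z * w) = sqn z * sqn w.
Proof. by case: z w => [a b] [c d]; rewrite /sqn /=; ring. Qed.

Lemma sqnD z w : sqn (z + w) <= 2 * sqn z + 2 * sqn w.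
Proof.
case: z w => [a b] [c d]; rewrite /sqn /= -subr_ge0.
have -> : 2 * (a ^+ 2 + b ^+ 2) + 2 * (c ^+ 2 + d ^+ 2) -
  ((a + c) ^+ 2 + (b + d) ^+ 2) = (a - c) ^+ 2 + (b - d) ^+ 2 by ring.
by rewrite addr_ge0 ?sqr_ge0.
Qed.

Lemma sqnV z : z != 0 -> sqn z^-1 = (sqn z)^-1.
Proof.
move=> z0; apply: (mulfI (x := sqn z)); first by rewrite sqn_eq0.
rewrite -sqnM mulfV // mulfV ?sqn_eq0 //.
by rewrite /sqn /= expr1n expr0n addr0.
Qed.

End Modulus.

(** * Norm bounds, convergence and completeness in l^2(V, m) *)

Section SquareSummable.
Variables (R : realType) (V : countType) (m : V -> R).
Hypothesis m_gt0 : forall x, 0 < m x.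
Implicit Types f g : V -> R[i].

(** The bound |f|^2 <= r on the squared norm, stated through finite partial sums so that no extended
    reals enter the estimates. *)
Definition l2le f (r : R) :=
  forall s : seq V, uniq s -> \sum_(x <- s) m x * sqn (f x) <= r.

Lemma l2le_ge0 f r : l2le f r -> 0 <= r.
Proof. by move=> /(_ [::] isT); rewrite big_nil. Qed.

Lemma l2le_trans f r s : r <= s -> l2le f r -> l2le f s.
Proof. by move=> rs fr t ut; exact: le_trans (fr t ut) rs. Qed.

Lemma l2le0 : l2le (fun=> 0) 0.
Proof. by move=> s _; rewrite big1 // => x _; rewrite sqn0 mulr0. Qed.

Lemma eq_l2le f g r : f =1 g -> l2le f r -> l2le g r.
Proof. by move=> /funext ->. Qed.

Lemma l2leN f g r : l2le (fun x => f x - g x) r -> l2le (fun x => g x - f x) r.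
Proof. by move=> fg s us; under eq_bigr do rewrite sqnB; exact: fg. Qed.

Lemma l2leD f g r s :
  l2le f r -> l2le g s -> l2le (fun x => f x + g x) (2 * r + 2 * s).
Proof.
move=> fr gs t ut.
apply: (@le_trans _ _ (\sum_(x <- t) (2 * (m x * sqn (f x)) +
                                      2 * (m x * sqn (g x))))).
  apply: ler_sum => x _.
  have := ler_wpM2l (ltW (m_gt0 x)) (sqnD (f x) (g x)).
  by move=> mfg; lra.
rewrite big_split /= -!mulr_sumr.
by apply: lerD; apply: ler_wpM2l => //; [exact: fr | exact: gs].
Qed.

Lemma l2leB f g h r s :
  l2le (fun x => f x - g x) r -> l2le (fun x => g x - h x) s ->
  l2le (fun x => f x - h x) (2 * r + 2 * s).
Proof.
move=> fr gs; have := l2leD fr gs.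
by apply: eq_l2le => x; ring.
Qed.

Lemma l2leZ (c : R[i]) f r : l2le f r -> l2le (fun x => c * f x) (sqn c * r).
Proof.
move=> fr s us; under eq_bigr do rewrite sqnM mulrCA.
by rewrite -mulr_sumr ler_wpM2l ?sqn_ge0 //; exact: fr.
Qed.

Lemma l2le_point f r x : l2le f r -> sqn (f x) <= (m x)^-1 * r.
Proof.
move=> /(_ [:: x] isT); rewrite big_seq1 => fr.
by rewrite ler_pdivlMl.
Qed.

Lemma l2le_eq0 f x : (forall e, 0 < e -> l2le f e) -> f x = 0.
Proof.
move=> fe; apply/eqP; rewrite -sqn_eq0 eq_le sqn_ge0 andbT.
apply/ler_addgt0Pl => e e0; rewrite addr0.
have := l2le_point x (fe _ (mulr_gt0 (m_gt0 x) e0)).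
by rewrite mulKf // gt_eqF.
Qed.

Lemma l2le_supp f (A : seq V) r : uniq A -> (forall x, f x != 0 -> x \in A) ->
  \sum_(x <- A) m x * sqn (f x) <= r -> l2le f r.
Proof.
move=> uA Af Ar s us; apply: le_trans Ar.
rewrite (bigID (mem A)) /= [X in _ + X]big1 ?addr0; last first.
  move=> x xA; have /eqP -> : f x == 0 by apply: contraNT xA => /Af.
  by rewrite sqn0 mulr0.
rewrite [leRHS](bigID (fun x => x \in s)) /=.
rewrite -big_filter -[X in _ <= X + _]big_filter.
rewrite (perm_big [seq x <- A | x \in s]) /=; last first.
  apply: uniq_perm; rewrite ?filter_uniq // => x.
  by rewrite !mem_filter andbC.
by rewrite lerDl sumr_ge0 // => x _; rewrite mulr_ge0 ?sqn_ge0 // ltW.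
Qed.

Lemma l2le_fin f : finite_set [set x | f x != 0] -> exists r, l2le f r.
Proof.
move=> /finite_fsetP[A Af]; exists (\sum_(x <- A) m x * sqn (f x)).
apply: l2le_supp (fset_uniq A) _ (lexx _) => x fx.
by have : [set x | f x != 0] x by []; rewrite Af.
Qed.

Lemma esum_l2le f r :
  (\esum_(x in [set: V]) (m x * ComplexField.Normc.normc (f x) ^+ 2)%:E
     <= r%:E)%E <-> l2le f r.
Proof.
split=> [fr s us | fr].
  rewrite -lee_fin; apply: le_trans fr; apply: esum_ge.
  exists [set` s]; first by split=> //; exact: finite_seq.
  rewrite -fsbig_seq // sumEFin lee_fin.
  by apply: ler_sum => x _; rewrite normc_sqn.
apply: ge_ereal_sup => _ [A [Afin _] <-].
rewrite fsbig_finite //= sumEFin lee_fin.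
under eq_bigr do rewrite normc_sqn.
by apply: fr; exact: fset_uniq.
Qed.

Let esumf_ge0 f :
  (0 <= \esum_(x in [set: V])
          (m x * ComplexField.Normc.normc (f x) ^+ 2)%:E)%E.
Proof.
apply: esum_ge0 => x _; rewrite lee_fin mulr_ge0 ?sqr_ge0 //; exact: ltW.
Qed.

Lemma l2norm_lt_l2le f (e : R) : (l2norm m f < e%:E)%E -> l2le f (e ^+ 2).
Proof.
move=> fe; apply/esum_l2le; move: fe; rewrite /l2norm.
case: (\esum_(x in _) _)%E (esumf_ge0 f) => [r||] //=; rewrite ?lee_fin => r0.
rewrite lte_fin => re; rewrite -[r]sqr_sqrtr // lerXn2r ?nnegrE ?sqrtr_ge0 //.
  exact: le_trans (sqrtr_ge0 _) (ltW re).
exact: ltW.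
Qed.

Lemma l2le_l2norm f r : l2le f r -> (l2norm m f <= (Num.sqrt r)%:E)%E.
Proof.
move=> fr; have /esum_l2le := fr; rewrite /l2norm.
case: (\esum_(x in _) _)%E (esumf_ge0 f) => [s||] //=; rewrite ?lee_fin => s0 sr.
by rewrite ler_sqrt // (le_trans s0).
Qed.

Lemma l2norm_ge0 f : (0 <= l2norm m f)%E.
Proof. exact: sqrte_ge0. Qed.

Lemma l2P f : l2 m f <-> exists r, l2le f r.
Proof.
split=> [|[r fr]]; last first.
  by apply: le_lt_trans (l2le_l2norm fr) _; rewrite ltry.
rewrite /l2 /=; case: (l2norm m f) (l2norm_ge0 f) (@l2norm_lt_l2le f) => //= r.
move=> _ /(_ (r + 1)) + _; rewrite lte_fin ltrDl => /(_ ltr01) fr.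
by exists ((r + 1) ^+ 2).
Qed.

Lemma l2norm_lt f r e : r < e ^+ 2 -> 0 < e -> l2le f r -> (l2norm m f < e%:E)%E.
Proof.
move=> re e0 fr; apply: le_lt_trans (l2le_l2norm fr) _.
by rewrite lte_fin -(gtr0_norm e0) -sqrtr_sqr ltr_sqrt // exprn_gt0.
Qed.

Definition l2cv (u : nat -> V -> R[i]) f :=
  forall e, 0 < e -> exists K, forall k, (K <= k)%N ->
    l2le (fun x => u k x - f x) e.

Lemma l2cvgP u f : l2cvg m u f <-> l2cv u f.
Proof.
split=> [uf e e0 | uf].
  have /uf : nbhs (0%E : \bar R) [set y | (y < (Num.sqrt e)%:E)%E].
    by apply: (@nbhs_open_ereal_lt _ 0 (fun=> Num.sqrt e)); rewrite sqrtr_gt0.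
  move=> [K _ uK]; exists K => k Kk; have /l2norm_lt_l2le := uK k Kk.
  by rewrite sqr_sqrtr // ltW.
have small e : 0 < e -> exists K, forall k, (K <= k)%N ->
    (l2norm m (fun x => (u k x - f x)%R) < e%:E)%E.
  move=> e0; have [|K uK] := uf (e ^+ 2 / 2).
    by rewrite divr_gt0 // exprn_gt0.
  exists K => k /uK; apply: l2norm_lt => //.
  by rewrite ltr_pdivrMr // ltr_pMr ?exprn_gt0 // ltr1n.
apply/fine_cvgP; split.
  have [K uK] := small _ ltr01; exists K => // k /= /uK.
  by move=> l1; rewrite ge0_fin_numE ?l2norm_ge0 // (lt_trans l1) // ltry.
apply/cvgrPdist_lt => e /small [K uK]; exists K => // k /= /uK.
have := l2norm_ge0 (fun x => u k x - f x); case: l2norm => [r||] //=.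
by rewrite lee_fin lte_fin => r0 re; rewrite sub0r normrN ger0_norm.
Qed.

Lemma l2cv_point u f x e : l2cv u f -> 0 < e ->
  exists K, forall k, (K <= k)%N -> sqn (u k x - f x) <= e.
Proof.
move=> uf e0; have [K uK] := uf _ (mulr_gt0 (m_gt0 x) e0).
exists K => k /uK /(l2le_point x); rewrite mulKf // gt_eqF //.
Qed.

Lemma inv_small (c e : R) : 0 <= c -> 0 < e ->
  exists K, forall k, (K <= k)%N -> c / k.+1%:R <= e.
Proof.
move=> c0 e0; exists (Num.bound (c / e)) => k Kk.
rewrite ler_pdivrMr // mulrC -ler_pdivrMr //.
apply: ltW; apply: lt_le_trans (archi_boundP _) _; first by rewrite divr_ge0 // ltW.
by rewrite ler_nat (leq_trans Kk).
Qed.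

Lemma real_complete (a : nat -> R) c : 0 <= c ->
    (forall k l, (a k - a l) ^+ 2 <= c / k.+1%:R + c / l.+1%:R) ->
  exists l, forall e, 0 < e -> exists K, forall k, (K <= k)%N ->
    (a k - l) ^+ 2 <= e.
Proof.
move=> c0 ac; have /cauchy_cvgP/cvg_ex[/= l al] : cauchy (a @ \oo).
  apply/cauchyP => e e0.
  have [|K cK] := inv_small (e := e ^+ 2 / 4) c0.
    by rewrite divr_gt0 // exprn_gt0.
  exists (a K); exists K => // k /= Kk; rewrite /ball /=.
  rewrite -ltr_sqr ?nnegrE ?normr_ge0 // ?(ltW e0) // real_normK ?num_real //.
  apply: le_lt_trans (ac K k) _.
  apply: le_lt_trans (lerD (cK K _) (cK k _)) _ => //.
  have := exprn_gt0 2 e0; lra.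
exists l => e e0; move/cvgrPdist_le: al => /(_ (Num.sqrt e)).
rewrite sqrtr_gt0 => /(_ e0) [K _ aK]; exists K => k /aK.
rewrite distrC -ler_sqr ?nnegrE ?sqrtr_ge0 // sqr_sqrtr ?(ltW e0) //.
by rewrite real_normK ?num_real.
Qed.

(** Coordinates are Cauchy because each [m x] is positive, which gives a pointwise limit [f]. On a
    finite set of vertices [u l] is close to [f] for large [l], so partial sums for [u k - f] are
    controlled by those for [u k - u l], uniformly in the finite set. *)
Lemma l2_complete (u : nat -> V -> R[i]) c : 0 <= c ->
    (forall k l, l2le (fun x => u k x - u l x) (c / k.+1%:R + c / l.+1%:R)) ->
  exists f, l2cv u f.
Proof.
move=> c0 uc.
have up x k l : sqn (u k x - u l x) <=
    ((m x)^-1 * c) / k.+1%:R + ((m x)^-1 * c) / l.+1%:R.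
  by rewrite -!mulrA -mulrDr; exact: (l2le_point x (uc k l)).
have mc x : 0 <= (m x)^-1 * c by rewrite mulr_ge0 // invr_ge0 ltW.
have /choice[f uf] : forall x, exists z : R[i], forall e, 0 < e ->
    exists K, forall k, (K <= k)%N -> sqn (u k x - z) <= e.
  move=> x.
  have [k l|a ua] := @real_complete (fun k => complex.Re (u k x)) _ (mc x).
    apply: le_trans (up x k l); rewrite /sqn.
    by case: (u k x) (u l x) => [? ?] [? ?] /=; rewrite lerDl sqr_ge0.
  have [k l|b ub] := @real_complete (fun k => complex.Im (u k x)) _ (mc x).
    apply: le_trans (up x k l); rewrite /sqn.
    by case: (u k x) (u l x) => [? ?] [? ?] /=; rewrite lerDr sqr_ge0.
  exists (a +i* b) => e e0; have e2 : 0 < e / 2 by rewrite divr_gt0.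
  have [Ka uKa] := ua _ e2; have [Kb uKb] := ub _ e2.
  exists (maxn Ka Kb) => k; rewrite geq_max => /andP[/uKa + /uKb].
  by rewrite /sqn; case: (u k x) => [? ?] /=; lra.
have us s e : 0 < e -> exists K, forall k, (K <= k)%N ->
    \sum_(x <- s) m x * sqn (u k x - f x) <= e.
  elim: s e => [|x s IH] e e0.
    by exists 0%N => k _; rewrite big_nil ltW.
  have e2 : 0 < e / 2 by rewrite divr_gt0.
  have [Ka uKa] := IH _ e2.
  have [|Kb uKb] := uf x ((m x)^-1 * (e / 2)); first by rewrite mulr_gt0 ?invr_gt0.
  exists (maxn Ka Kb) => k; rewrite geq_max => /andP[/uKa a2 /uKb].
  by rewrite ler_pdivlMl // => b2; rewrite big_cons; lra.
(* For [l >= k] the Cauchy bound is at most [2 * (c / k.+1%:R)]; inserting [u l] doubles it. *)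
have uk k : l2le (fun x => u k x - f x) (4 * (c / k.+1%:R)).
  move=> s ss; apply/ler_addgt0Pl => e e0.
  have [|K uK] := us s (e / 2); first by rewrite divr_gt0.
  set l := maxn k K.
  have kl : c / l.+1%:R <= c / k.+1%:R.
    by rewrite ler_wpM2l // lef_pV2 ?posrE // ler_nat ltnS leq_maxl.
  have b2 := uK l (leq_maxr _ _); have a2 := uc k l s ss.
  apply: (@le_trans _ _ (2 * (c / k.+1%:R + c / l.+1%:R) + 2 * (e / 2)));
    last first.
    by move: kl; set z := c / _; set y := c / _; lra.
  apply: (@le_trans _ _ (\sum_(x <- s) (2 * (m x * sqn (u k x - u l x)) +
                                      2 * (m x * sqn (u l x - f x))))).
    apply: ler_sum => x _.
    have := ler_wpM2l (ltW (m_gt0 x)) (sqnD (u k x - u l x) (u l x - f x)).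
    by rewrite addrA subrK => mfg; lra.
  rewrite big_split /= -!mulr_sumr.
  by apply: lerD; apply: ler_wpM2l.
exists f => e e0; have [|K cK] := inv_small (e := e / 4) c0.
  by rewrite divr_gt0.
exists K => k /cK ck; apply: l2le_trans (uk k).
by move: ck; set z := c / _; lra.
Qed.

End SquareSummable.

(** * A priori estimates, closed range and finite-dimensional kernel *)

Section ClosedRange.
Variables (R : realType) (V : countType) (m : V -> R).
Hypothesis m_gt0 : forall x, 0 < m x.
Variable T : (V -> R[i]) -> V -> R[i].
Hypothesis T_linear : forall a f g x,
  T (fun y => a * f y + g y) x = a * T f x + T g x.
Implicit Types (f g : V -> R[i]) (D : set (V -> R[i])) (W : seq V).

Lemma linear_op0 x : T (fun=> 0) x = 0.
Proof.
have := T_linear 1 (fun=> 0) (fun=> 0) x.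
under [X in T X]funext do rewrite mulr0 addr0.
by rewrite mul1r -[LHS]addr0 => /addrI.
Qed.

Lemma linear_opZ a f x : T (fun y => a * f y) x = a * T f x.
Proof.
rewrite -[RHS]addr0 -(linear_op0 x) -T_linear.
by congr (T _ x); apply/funext => y; rewrite addr0.
Qed.

Lemma linear_opB f g x : T (fun y => f y - g y) x = T f x - T g x.
Proof.
rewrite addrC -mulN1r -T_linear.
by congr (T _ x); apply/funext => y; rewrite mulN1r addrC.
Qed.

Definition subspace_set D :=
  D (fun=> 0) /\
  forall a f g, D f -> D g -> D (fun x => a * f x + g x).

Definition closed_on D := forall u f g, (forall k, D (u k)) ->
  l2cv m u f -> l2cv m (fun k => T (u k)) g -> D f /\ T f =1 g.

(** The estimate |f|^2 <= C (|T f|^2 + max_W |f|^2), up to the value of the constant: one number [r]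
    bounds both terms. *)
Definition apriori D W C := forall f r, D f -> l2le m (T f) r ->
  (forall x, x \in W -> sqn (f x) <= r) -> l2le m f (C * r).

Lemma subspace_setB D f g : subspace_set D -> D f -> D g ->
  D (fun x => f x - g x).
Proof.
move=> [_ DD] Df Dg; have := DD (-1) _ _ Dg Df; congr D.
by apply/funext => x; rewrite mulN1r addrC.
Qed.

Lemma subspace_setZ D a f : subspace_set D -> D f -> D (fun x => a * f x).
Proof.
move=> [D0 DD] Df; have := DD a _ _ Df D0; congr D.
by apply/funext => x; rewrite addr0.
Qed.

(** The estimate applied to differences [u k - u l] makes [u] Cauchy, since the images and the
    values on [W] are; completeness gives a limit and closedness puts it in [D]. *)
Lemma apriori_limit D W C u g c : subspace_set D -> closed_on D ->
    0 < C -> apriori D W C -> 0 <= c -> (forall k, D (u k)) ->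
    (forall k, l2le m (fun x => T (u k) x - g x) (c / k.+1%:R)) ->
    (forall k l x, x \in W ->
      sqn (u k x - u l x) <= 2 * (c / k.+1%:R) + 2 * (c / l.+1%:R)) ->
  exists f, [/\ D f, T f =1 g & l2cv m u f].
Proof.
move=> Ds Dc C0 DW c0 Du ug uW.
have [|k l|f uf] := @l2_complete _ _ _ m_gt0 u (2 * C * c).
- by rewrite !mulr_ge0 // ltW.
- have := DW (fun x => u k x - u l x) (2 * (c / k.+1%:R) + 2 * (c / l.+1%:R)).
  rewrite -!mulrA mulrDr [C * (2 * _)]mulrCA [C * (2 * _)]mulrCA; apply => //.
  + exact: subspace_setB.
  + have := l2leB m_gt0 (ug k) (l2leN (ug l)).
    by apply: eq_l2le => x; rewrite linear_opB.
  + by move=> x; exact: uW.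
have [|Df Tf] := Dc u f g Du uf; last by exists f.
move=> e e0; have [K cK] := inv_small c0 e0; exists K => k /cK ck.
exact: l2le_trans ck (ug k).
Qed.

(* One point [w] of [W] is removed at a time: either the kernel contains an
   [e] with [e w != 0] and one may restrict to [f w = 0], or the value at [w]
   is already controlled by the rest of the estimate, by completeness. *)
Lemma apriori_closed_range D W C g : subspace_set D -> closed_on D ->
    0 < C -> apriori D W C ->
    (forall e, 0 < e -> exists2 f, D f & l2le m (fun x => T f x - g x) e) ->
  exists2 f, D f & T f =1 g.
Proof.
elim: W D C => [|w W IH] D C Ds Dc C0 DW Dg.
  have /choice[u uP] : forall k : nat, exists f, D f /\
      l2le m (fun x => T f x - g x) (1 / k.+1%:R).
    by move=> k; have [|f] := Dg (1 / k.+1%:R); [rewrite divr_gt0|exists f].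
  have [k|k|//|f [Df Tf _]] := apriori_limit Ds Dc C0 DW ler01 (u := u) (g := g).
  - by case: (uP k).
  - by case: (uP k).
  by exists f.
have [[e [De Te ew]]|noe] := pselect
    (exists e, [/\ D e, T e =1 (fun=> 0) & e w != 0]).
  have [||//|||f [Df _] Tf] := IH [set f | D f /\ f w = 0] C; last by exists f.
  - by case: Ds => D0 DD; split=> // a f h [Df fw] [Dh hw]; split;
      [exact: DD|rewrite fw hw mulr0 addr0].
  - move=> u f h Du uf uh; have [Df Tf] := Dc u f h (fun k => (Du k).1) uf uh.
    split=> //; split=> //; apply/eqP; rewrite -sqn_eq0 eq_le sqn_ge0 andbT.
    apply/ler_addgt0Pl => d d0; rewrite addr0.
    have [K uK] := l2cv_point m_gt0 w uf d0.
    by have := uK K (leqnn _); rewrite (Du K).2 sub0r sqnN.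
  - move=> f r [Df fw] Tfr fW; apply: DW => // x.
    rewrite inE => /orP[/eqP ->|/fW //].
    by rewrite fw sqn0; exact: l2le_ge0 Tfr.
  (* Subtracting a multiple of [e] makes an approximant vanish at [w] without changing its image. *)
  move=> d d0; have [f Df fg] := Dg _ d0.
  exists (fun x => - (f w / e w) * e x + f x).
    split; first by case: Ds => _; apply.
    by rewrite mulNr divfK // addNr.
  by apply: eq_l2le fg => x; rewrite T_linear Te mulr0 add0r.
have [[C' C'0 DW']|noC] := pselect (exists2 C', 0 < C' & apriori D W C').
  exact: (IH D C').
exfalso.
(* The estimate over [W] fails for each constant [C * k.+1%:R]. A counterexample must be dominated
   by its value at [w]; rescaled to take the value 1 there, it has a small image and small values on
   [W]. These functions converge to a kernel element that is nonzero at [w], against [noe]. *)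
have /choice[u uP] : forall k : nat, exists f, [/\ D f, f w = 1,
    l2le m (T f) (1 / k.+1%:R) & forall x, x \in W -> sqn (f x) <= 1 / k.+1%:R].
  move=> k; have k0 : 0 < k.+1%:R :> R by [].
  have [f [r [Df Tf fW nf]]] : exists f r, [/\ D f, l2le m (T f) r,
      forall x, x \in W -> sqn (f x) <= r & ~ l2le m f (C * k.+1%:R * r)].
    apply: contra_notP noC => nof; exists (C * k.+1%:R); first exact: mulr_gt0.
    by move=> f r Df Tf fW; apply: contra_notP nof => nf; exists f, r.
  have r0 := l2le_ge0 Tf.
  (* Otherwise the estimate over [w :: W] would apply with the same [r]. *)
  have rs : r < sqn (f w).
    rewrite ltNge; apply/negP => sr; apply: nf.
    apply: (@l2le_trans _ _ _ _ (C * r)).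
      by rewrite ler_wpM2r // ler_peMr ?(ltW C0) // ler1n.
    by apply: DW => // x; rewrite inE => /orP[/eqP ->|/fW].
  have s0 : 0 < sqn (f w) by exact: le_lt_trans rs.
  have fw0 : f w != 0 by rewrite -sqn_eq0 gt_eqF.
  (* The estimate over [w :: W], now with bound [sqn (f w)], would otherwise contradict [nf]. *)
  have krs : (sqn (f w))^-1 * r <= 1 / k.+1%:R.
    rewrite ler_pdivrMl // mulrA mulr1 ler_pdivlMr // leNgt.
    apply/negP => srk; apply: nf; apply: (@l2le_trans _ _ _ _ (C * sqn (f w))).
      by rewrite -mulrA ler_wpM2l ?(ltW C0) // mulrC ltW.
    apply: DW => //; first exact: l2le_trans (ltW rs) Tf.
    move=> x; rewrite inE => /orP[/eqP -> //|/fW fx].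
    exact: le_trans fx (ltW rs).
  exists (fun x => (f w)^-1 * f x); split.
  - exact: subspace_setZ.
  - by rewrite mulVf.
  - have := l2leZ (f w)^-1 Tf; rewrite sqnV // => Tr.
    apply: l2le_trans krs _; apply: eq_l2le Tr => x; by rewrite linear_opZ.
  - move=> x /fW fx; apply: le_trans krs.
    by rewrite sqnM sqnV // ler_wpM2l // invr_ge0 ltW.
have [k|k|k l x|f [Df Tf uf]] :=
    apriori_limit Ds Dc C0 DW ler01 (u := u) (g := fun=> 0).
- by case: (uP k).
- by case: (uP k) => _ _ + _; apply: eq_l2le => x; rewrite subr0.
- have ge0 j : 0 <= 1 / j.+1%:R :> R by rewrite divr_ge0.
  rewrite inE => /orP[/eqP ->|xW].
    case: (uP k) (uP l) => _ -> _ _ [_ -> _ _].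
    by rewrite subrr sqn0 addr_ge0 // mulr_ge0.
  apply: le_trans (sqnD _ _) _; rewrite sqnN.
  by apply: lerD; rewrite ler_wpM2l //; [case: (uP k)|case: (uP l)] => _ _ _; apply.
apply: noe; exists f; split=> //; apply/eqP => fw.
have [|K uK] := l2cv_point m_gt0 w uf (e := 1 / 2); first by rewrite divr_gt0.
have := uK K (leqnn _); case: (uP K) => _ -> _ _.
rewrite fw subr0 /sqn /= expr1n expr0n addr0 /=; lra.
Qed.

(** On the kernel the estimate makes restriction to [W] injective. Among [(size W).+1] kernel
    elements a nontrivial combination vanishes on [W], because the matrix of values has more rows
    than columns; hence it vanishes everywhere. *)
Lemma apriori_finite_kernel D W C :
  apriori D W C -> subspace_set D ->
  ~ infinite_dim [set f | D f /\ forall x, T f x = 0].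
Proof.
move=> DW Ds /(_ (size W).+1) [f [fK ind]].
pose A : 'M[R[i]]_((size W).+1, size W) := \matrix_(i, j) f i (tnth (in_tuple W) j).
have : kermx A != 0.
  rewrite -mxrank_eq0 mxrank_ker -lt0n subn_gt0.
  by rewrite (leq_ltn_trans (rank_leq_col A)).
move=> /rowV0Pn[v /sub_kermxP vA v0].
pose h x := \sum_i v 0 i * f i x.
have [Dh Th] : D h /\ forall x, T h x = 0.
  rewrite /h; elim: (index_enum _) => [|i r [Dr Tr]].
    under eq_fun do rewrite big_nil; split; first by case: Ds.
    by move=> x; exact: linear_op0.
  under eq_fun do rewrite big_cons.
  split; first by case: Ds => _; apply => //; case: (fK i).
  by move=> x; rewrite T_linear Tr (fK i).2 mulr0 addr0.
have hW x : x \in W -> h x = 0.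
  move=> xW; have xs : (index x W < size W)%N by rewrite index_mem.
  have /matrixP/(_ 0 (Ordinal xs)) := vA; rewrite !mxE => h0.
  rewrite -[RHS]h0; apply: eq_bigr => i _; rewrite !mxE; congr (_ * f i _).
  by rewrite (tnth_nth x) /= nth_index.
have h0 : l2le m h (C * 0).
  apply: DW => //; first by apply: eq_l2le (l2le0 m) => x; rewrite Th.
  by move=> x /hW ->; rewrite sqn0.
case/eqP: v0; apply/rowP => i; rewrite mxE; apply: (ind (fun i => v 0 i)) => x.
apply: (l2le_eq0 m_gt0 (f := h)) => e e0.
by apply: l2le_trans h0; rewrite mulr0 ltW.
Qed.

End ClosedRange.

Lemma seq_min (R : realType) (T : eqType) (v : T -> R) (l : seq T) :
  l != [::] -> exists2 x, x \in l & forall y, y \in l -> v x <= v y.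
Proof.
elim: l => // x [_ _|y l /(_ isT) [z zl vz] _].
  by exists x; rewrite ?mem_head // => y; rewrite inE => /eqP ->.
have [xz|/ltW zx] := leP (v x) (v z).
  exists x; first exact: mem_head.
  by move=> t; rewrite inE => /orP[/eqP -> //|/vz]; exact: le_trans.
exists z; first by rewrite inE zl orbT.
by move=> t; rewrite inE => /orP[/eqP ->|/vz].
Qed.

(** * Edge sums, the co-area formula and Cheeger's inequality *)

Section Cheeger.
Variables (R : realType) (V : countType) (G : wdigraph R V).
Hypothesis G_lf : locally_finite G.
Hypothesis beta_eq : forall x, beta_out G x = beta_in G x.
Local Notation b := (weight G).

Definition nbr (x : V) : {fset V} := fset_set [set y | 0 < b x y \/ 0 < b y x].

Lemma nbr_out x y : y \notin nbr x -> b x y = 0.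
Proof.
rewrite in_fset_set ?notin_setE /=; last exact: G_lf.
by move=> nxy; apply/eqP; rewrite eq_le weight_ge0 andbT leNgt;
  apply/negP => bxy; apply: nxy; left.
Qed.

Lemma nbr_in x y : y \notin nbr x -> b y x = 0.
Proof.
rewrite in_fset_set ?notin_setE /=; last exact: G_lf.
by move=> nxy; apply/eqP; rewrite eq_le weight_ge0 andbT leNgt;
  apply/negP => bxy; apply: nxy; right.
Qed.

Lemma mem_nbr x y : (y \in nbr x) = (x \in nbr y).
Proof.
rewrite !in_fset_set; [|exact: G_lf..].
by apply/idP/idP => /set_mem /= xy; apply/mem_set => /=; tauto.
Qed.

Lemma beta_outE x (s : {fset V}) : {subset nbr x <= s} ->
  beta_out G x = \sum_(y <- s) b x y.
Proof. by move=> xs; apply: fsbigTE => y /(contra (xs y)) /nbr_out. Qed.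

Lemma beta_inE x (s : {fset V}) : {subset nbr x <= s} ->
  beta_in G x = \sum_(y <- s) b y x.
Proof. by move=> xs; apply: fsbigTE => y /(contra (xs y)) /nbr_in. Qed.

(** Every edge meeting [P] then has both ends in [s], so that edge sums become finite double sums
    over [s]. *)
Definition covers (s : {fset V}) (P : set V) :=
  forall x, P x -> x \in s /\ {subset nbr x <= s}.

Lemma cover_finite (P : set V) : finite_set P -> exists s, covers s P.
Proof.
move=> /finite_fsetP[A ->]; elim/finmap.fset1U_rect: A => [|a A _ [s sA]].
  by exists fset0 => x.
exists (a |` s `|` nbr a)%fset => x /=; rewrite in_fset1U => /orP[/eqP ->|xA].
  by split=> [|y ya]; rewrite !inE ?eqxx ?ya ?orbT.
by have [xs sx] := sA x xA; split=> [|y /sx ys]; rewrite !inE ?xs ?ys ?orbT.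
Qed.

Definition wsum (s : {fset V}) (F : V -> V -> R) : R :=
  \sum_(x <- s) \sum_(y <- s) b x y * F x y.

Lemma wsumD s F1 F2 :
  wsum s (fun x y => F1 x y + F2 x y) = wsum s F1 + wsum s F2.
Proof.
rewrite /wsum -big_split; apply: eq_bigr => x _; rewrite -big_split /=.
by apply: eq_bigr => y _; rewrite mulrDr.
Qed.

Lemma wsumZ s c F : wsum s (fun x y => c * F x y) = c * wsum s F.
Proof.
rewrite /wsum mulr_sumr; apply: eq_bigr => x _; rewrite mulr_sumr.
by apply: eq_bigr => y _; rewrite mulrCA.
Qed.

Lemma eq_wsum s F1 F2 : (forall x y, F1 x y = F2 x y) -> wsum s F1 = wsum s F2.
Proof. by move=> F12; do 2![apply: eq_bigr => ? _]; rewrite F12. Qed.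

Lemma le_wsum s F1 F2 : (forall x y, F1 x y <= F2 x y) -> wsum s F1 <= wsum s F2.
Proof.
by move=> F12; do 2![apply: ler_sum => ? _]; rewrite ler_wpM2l ?weight_ge0.
Qed.

Lemma wsum_ge0 s F : (forall x y, 0 <= F x y) -> 0 <= wsum s F.
Proof.
by move=> F0; do 2![apply: sumr_ge0 => ? _]; rewrite mulr_ge0 ?weight_ge0.
Qed.

(** A boundary edge has one end in [U], hence both in [s]; a pair separated by [U] that is not an
    edge has weight 0. *)
Lemma weight_boundaryE (U : set V) s : covers s U ->
  weight_boundary G U = wsum s (fun x y => ((x \in U) (+) (y \in U))%:R).
Proof.
move=> sU; have Us x y : edge_boundary G U (x, y) ->
    [/\ 0 < b x y, (x \in U) (+) (y \in U), x \in s & y \in s].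
  move=> /= [] /weight_gt0 /= bxy xyU.
  have xy : y \in nbr x by apply: contraTT bxy => /nbr_out ->; rewrite ltxx.
  have yx : x \in nbr y by rewrite mem_nbr.
  case: xyU => -[xU yU].
    have [xs sx] := sU x xU.
    by rewrite (mem_set xU) (memNset yU); split => //; exact: sx.
  have [ys sy] := sU y yU.
  by rewrite (memNset xU) (mem_set yU); split => //; exact: sy.
rewrite /weight_boundary (fsbigE [seq e <- [seq (x, y) | x <- s, y <- s] |
  e \in edge_boundary G U]).
- rewrite big_filter_cond; under eq_bigl do rewrite andbb.
  rewrite big_mkcond big_allpairs /= /wsum; apply: eq_bigr => x _.
  apply: eq_bigr => y _.
  case: ifPn => [/set_mem/Us[_ -> _ _]|/negP nU]; first by rewrite mulr1.
  have [xyU|] := boolP (_ (+) _); last by rewrite mulr0.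
  rewrite mulr1; apply/esym/eqP; rewrite eq_le weight_ge0 andbT leNgt.
  apply/negP => bxy; apply: nU; apply/mem_set; split; first exact/weight_gt0.
  move: xyU; case: (boolP (x \in U)); case: (boolP (y \in U)) => //=.
    by move=> /negP yU /set_mem xU _; left; split => // /mem_set.
  by move=> /set_mem yU /negP xU _; right; split => // /mem_set.
- by rewrite filter_uniq // allpairs_uniq ?fset_uniq // => -[? ?] [? ?].
- by move=> e /=; rewrite mem_filter => /andP[/set_mem].
- move=> [x y] Uxy; rewrite mem_filter (mem_set Uxy) /= => /negP[].
  by have [_ _ xs ys] := Us x y Uxy; apply/allpairsP; exists (x, y).
Qed.

(** The boundary of a single vertex is made of its outgoing and incoming edges, of total weight
    beta^+ + beta^-. This bounds the Cheeger constants from above, and so makes them finite. *)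
Lemma weight_boundary1_le x : weight_boundary G [set x] <= 2 * beta_out G x.
Proof.
have [s sx] := cover_finite (finite_set1 x).
have [xs nx] := sx x erefl.
have -> : 2 * beta_out G x = beta_out G x + beta_in G x.
  by rewrite -beta_eq mulr_natl.
rewrite (weight_boundaryE sx) (beta_outE nx) (beta_inE nx).
have -> : \sum_(y <- s) b x y = wsum s (fun z y => (z == x)%:R).
  rewrite [RHS](bigD1_seq x xs (fset_uniq s)) /= [X in _ + X]big1 ?addr0.
    by apply: eq_bigr => y _; rewrite eqxx mulr1.
  by move=> z /negPf ->; rewrite big1 // => y _; rewrite mulr0.
have -> : \sum_(y <- s) b y x = wsum s (fun y z => (z == x)%:R).
  rewrite /wsum; apply: eq_bigr => y _.
  rewrite (bigD1_seq x xs (fset_uniq s)) /= big1 ?addr0 ?eqxx ?mulr1 //.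
  by move=> z /negPf ->; rewrite mulr0.
rewrite -wsumD; apply: le_wsum => y z.
have mem1 t : (t \in [set x]) = (t == x) by rewrite in_set1.
by rewrite !mem1; case: eqP; case: eqP => _ _ /=; lra.
Qed.

(* Layer-cake decomposition: subtracting from [v] its least nonzero value on
   its support shrinks the support and lowers both sides by a multiple of the
   isoperimetric inequality for that support. *)
Lemma coarea (mu : V -> R) (h : R) (Om : set V) (s : {fset V}) (v : V -> R) :
    (forall U, finite_parts Om U ->
       h * (\sum_(x \in U) mu x) <= weight_boundary G U) ->
    (forall x, 0 <= v x) ->
    covers s [set x | v x != 0] -> [set x | v x != 0] `<=` Om ->
  h * \sum_(x <- s) mu x * v x <= wsum s (fun x y => `|v x - v y|).
Proof.
move=> hU; have [n] := ubnP (size [seq x <- s | v x != 0]).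
elim: n v => // n IH v; rewrite ltnS => vn v0 sv vO.
set l := [seq x <- s | v x != 0] in vn.
have memU x : (x \in [set x | v x != 0]) = (v x != 0).
  by apply/idP/idP => [/set_mem|?] //; exact/mem_set.
have meml x : (x \in l) = (v x != 0).
  rewrite mem_filter; case: (boolP (v x != 0)) => //= vx.
  by have [] := sv x vx.
have [l0|l0] := eqVneq l [::].
  rewrite big1; first by rewrite mulr0 wsum_ge0.
  move=> x _; have : x \notin l by rewrite l0.
  by rewrite meml negbK => /eqP ->; rewrite mulr0.
have [x0 x0l vmin] := seq_min v l0.
set c := v x0; have c0 : 0 < c by rewrite lt0r v0 andbT -meml.
pose v' x := if v x != 0 then v x - c else 0.
have v'0 x : 0 <= v' x.
  by rewrite /v'; case: ifP => // vx; rewrite subr_ge0 vmin // meml.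
have v'v x : v' x != 0 -> v x != 0.
  by rewrite /v'; case: ifP => //; rewrite eqxx.
have v'x0 : v' x0 = 0 by rewrite /v' subrr if_same.
have IHv' : h * \sum_(x <- s) mu x * v' x <= wsum s (fun x y => `|v' x - v' y|).
  apply: IH => //.
  (* The support of [v'] is strictly smaller: it loses [x0]. *)
  - apply: leq_trans vn; apply: (@uniq_leq_size _ (x0 :: [seq x <- s | v' x != 0])).
      by rewrite /= filter_uniq ?fset_uniq // andbT mem_filter v'x0 eqxx.
    move=> x; rewrite inE => /orP[/eqP -> //|].
    by rewrite mem_filter meml => /andP[/v'v].
  - by move=> x /v'v; exact: sv.
  - by move=> x /v'v; exact: vO.
have hUv : h * (\sum_(x <- s) mu x * (v x != 0)%:R) <=
    wsum s (fun x y => ((v x != 0) (+) (v y != 0))%:R).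
  have := hU [set x | v x != 0].
  rewrite (weight_boundaryE sv) (fsbigE l) //; first last.
  - by move=> x /= vx; rewrite meml vx.
  - by move=> x /=; rewrite meml.
  - by rewrite filter_uniq // fset_uniq.
  rewrite big_filter_cond big_mkcond /= => hl.
  have -> : \sum_(x <- s) mu x * (v x != 0)%:R =
      \sum_(i <- s) (if (v i != 0) && (i \in [set x | v x != 0]) then mu i else 0).
    by apply: eq_bigr => x _; rewrite memU andbb; case: ifP; rewrite ?mulr1 ?mulr0.
  apply: (le_trans (hl _)); last first.
    by apply: le_wsum => x y; rewrite !memU.
  split => //; last by exists x0; rewrite /= -meml.
  apply: (sub_finite_set (B := [set` s])); last exact: finite_fset.
  by move=> x /sv[].
have -> : \sum_(x <- s) mu x * v x =
    \sum_(x <- s) mu x * v' x + c * \sum_(x <- s) mu x * (v x != 0)%:R.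
  rewrite mulr_sumr -big_split; apply: eq_bigr => x _ /=.
  by rewrite /v'; case: eqP => /= [->|_]; ring.
(* A difference loses exactly [c] when just one of the two values is 0, by minimality of [c], and is
   unchanged otherwise. *)
rewrite (@eq_wsum _ _ (fun x y => `|v' x - v' y| +
    c * ((v x != 0) (+) (v y != 0))%:R)).
  rewrite wsumD wsumZ mulrDr mulrCA; apply: lerD => //.
  by rewrite ler_pM2l.
move=> x y; rewrite /v'; case: eqP => [->|/eqP vx]; case: eqP => [->|/eqP vy] /=.
- by rewrite subrr mulr0 addr0.
- rewrite !sub0r !normrN mulr1 !ger0_norm ?subrK //.
  by rewrite subr_ge0 vmin // meml.
- rewrite !subr0 mulr1 !ger0_norm ?subrK //.
  by rewrite subr_ge0 vmin // meml.
- by rewrite mulr0 addr0; congr (`|_|); ring.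
Qed.

(** The co-area formula is applied to [u ^+ 2], whose differences factor as (u(x) - u(y)) (u(x) +
    u(y)). A free [mu] serves both inequalities: [m] with [M] a bound of beta^+ / m, or beta^+
    itself with [M = 1]. *)
Lemma cheeger_form (mu : V -> R) (h M : R) (Om : set V) (s : {fset V})
    (u : V -> R) :
    (forall U, finite_parts Om U ->
       h * (\sum_(x \in U) mu x) <= weight_boundary G U) ->
    0 <= h -> 0 < M ->
    (forall x, Om x -> beta_out G x <= M * mu x) ->
    covers s [set x | u x != 0] -> [set x | u x != 0] `<=` Om ->
  h ^+ 2 * \sum_(x <- s) mu x * u x ^+ 2 <=
    8 * M * wsum s (fun x y => (u x - u y) * u x).
Proof.
move=> hU h0 M0 bM su uO.
set S := \sum_(x <- s) _; set Q := wsum s _.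
pose B := \sum_(x <- s) beta_out G x * u x ^+ 2.
have BM : B <= M * S.
  rewrite mulr_sumr; apply: ler_sum => x _; rewrite mulrA.
  have [->|ux] := eqVneq (u x) 0; first by rewrite expr0n !mulr0.
  by rewrite ler_wpM2r ?sqr_ge0 // bM //; exact: uO.
have Bout : wsum s (fun x y => u x ^+ 2) = B.
  apply: eq_bigr => x _; rewrite -mulr_suml.
  have [->|ux] := eqVneq (u x) 0; first by rewrite expr0n !mulr0.
  by congr (_ * _); rewrite (@beta_outE _ s) //; case: (su x ux).
have Bin : wsum s (fun x y => u y ^+ 2) = B.
  rewrite /wsum exchange_big; apply: eq_bigr => x _ /=; rewrite -mulr_suml.
  have [->|ux] := eqVneq (u x) 0; first by rewrite expr0n !mulr0.
  by congr (_ * _); rewrite beta_eq (@beta_inE _ s) //; case: (su x ux).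
pose P := wsum s (fun x y => (u x - u y) ^+ 2).
have P0 : 0 <= P by apply: wsum_ge0 => x y; exact: sqr_ge0.
(* Expanding the square leaves the sums of b(x,y) u(x)^2 and b(x,y) u(y)^2, which agree because
   beta^+ = beta^-. *)
have PQ : P = 2 * Q.
  have : 2 * Q + B = P + B.
    rewrite -{1}Bin -Bout /Q -wsumZ -!wsumD; apply: eq_wsum => x y; ring.
  by move/addIr.
(* Parallelogram identity, dropping the nonnegative term [P]. *)
have plus : wsum s (fun x y => (u x + u y) ^+ 2) <= 4 * B.
  have : wsum s (fun x y => (u x + u y) ^+ 2) + P = 2 * B + 2 * B.
    rewrite -{1}Bout -Bin -!wsumZ -!wsumD; apply: eq_wsum => x y; ring.
  lra.
have [->|hn0] := eqVneq h 0.
  by rewrite expr0n mul0r !mulr_ge0 ?(ltW M0) //; lra.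
have hgt0 : 0 < h by rewrite lt0r hn0.
(* AM-GM; the optimal parameter is [t = 4 M / h]. *)
have key t : 0 < t -> h * S <= t * Q + 2 * t^-1 * B.
  move=> t0.
  have hA : h * S <= wsum s (fun x y => `|u x ^+ 2 - u y ^+ 2|).
    apply: coarea hU _ _ _ => [x|x|x]; rewrite ?sqr_ge0 //=.
      by rewrite sqrf_eq0; exact: su.
    by rewrite sqrf_eq0; exact: uO.
  apply: le_trans hA _.
  apply: (@le_trans _ _ (wsum s (fun x y => (t / 2) * (u x - u y) ^+ 2 +
    (t^-1 / 2) * (u x + u y) ^+ 2))).
    apply: le_wsum => x y; rewrite subr_sqr normrM.
    rewrite -[in leRHS](real_normK (num_real (u x - u y))).
    rewrite -[in leRHS](real_normK (num_real (u x + u y))).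
    set d := `|u x - u y|; set e := `|u x + u y|.
    have := sqr_ge0 (t * d - e) => sq.
    rewrite -(ler_pM2l t0).
    have -> : t * (t / 2 * d ^+ 2 + t^-1 / 2 * e ^+ 2) =
      (t ^+ 2 * d ^+ 2 + e ^+ 2) / 2 by field; rewrite gt_eqF.
    by lra.
  rewrite wsumD !wsumZ -/P PQ.
  have := ler_wpM2l (ltW (_ : 0 < t^-1 / 2)) plus.
  have ti : 0 < t^-1 / 2 by rewrite divr_gt0 // invr_gt0.
  move=> /(_ ti); lra.
(* For this [t] the term in [B] is at most [h * S / 2] and is absorbed on the left, leaving
   [h * S / 2 <= 4 * M / h * Q]. *)
have := key (4 * M / h) (divr_gt0 (mulr_gt0 (ltr0n _ 4) M0) hgt0).
have -> : 2 * (4 * M / h)^-1 * B = h / 2 * (M^-1 * B).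
  by field; rewrite !gt_eqF.
have BS : M^-1 * B <= S by rewrite ler_pdivrMl.
have := ler_wpM2l (ltW (divr_gt0 hgt0 (ltr0n R 2))) BS => hB hS.
have : h * S - h / 2 * S <= 4 * M / h * Q by lra.
rewrite -(ler_pM2l hgt0).
have -> : h * (4 * M / h * Q) = 4 * M * Q by field; rewrite gt_eqF.
lra.
Qed.

End Cheeger.

(** * Limits of complex sequences *)

Section PointwiseLimit.
Variable R : realType.
Implicit Types (u v : nat -> R[i]) (z w : R[i]).

Definition ptends u z := forall e, 0 < e ->
  exists K, forall k, (K <= k)%N -> sqn (u k - z) <= e.

Lemma ptends_cst z : ptends (fun=> z) z.
Proof. by move=> e e0; exists 0%N => k _; rewrite subrr sqn0 ltW. Qed.

Lemma ptendsD u v z w : ptends u z -> ptends v w ->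
  ptends (fun k => u k + v k) (z + w).
Proof.
move=> uz vw e e0; have e4 : 0 < e / 4 by rewrite divr_gt0.
have [K uK] := uz _ e4; have [K' vK] := vw _ e4.
exists (maxn K K') => k; rewrite geq_max => /andP[/uK uk /vK vk].
have -> : u k + v k - (z + w) = (u k - z) + (v k - w) by ring.
by apply: le_trans (sqnD _ _) _; lra.
Qed.

Lemma ptendsZ a u z : ptends u z -> ptends (fun k => a * u k) (a * z).
Proof.
move=> uz e e0; have a0 : 0 < sqn a + 1 by rewrite ltr_wpDl ?sqn_ge0.
have [|K uK] := uz (e / (sqn a + 1)); first by rewrite divr_gt0.
exists K => k /uK; rewrite -mulrBr sqnM ler_pdivlMr // => uk.
by have := sqn_ge0 (u k - z); lra.
Qed.

Lemma ptendsB u v z w : ptends u z -> ptends v w ->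
  ptends (fun k => u k - v k) (z - w).
Proof.
move=> uz /(ptendsZ (-1)) vw; have := ptendsD uz vw.
by rewrite mulN1r; under [X in ptends X]funext do rewrite mulN1r.
Qed.

Lemma ptends_sum (I : Type) (r : seq I) (u : I -> nat -> R[i]) (z : I -> R[i]) :
  (forall i, ptends (u i) (z i)) ->
  ptends (fun k => \sum_(i <- r) u i k) (\sum_(i <- r) z i).
Proof.
move=> uz; elim: r => [|i r IH].
  rewrite big_nil; under [X in ptends X]funext do rewrite big_nil.
  exact: ptends_cst.
rewrite big_cons; under [X in ptends X]funext do rewrite big_cons.
exact: ptendsD.
Qed.

Lemma ptends_unique u z w : ptends u z -> ptends u w -> z = w.
Proof.
move=> uz uw; apply/eqP; rewrite -subr_eq0 -sqn_eq0 eq_le sqn_ge0 andbT.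
apply/ler_addgt0Pl => e e0; rewrite addr0.
have [K uK] := ptendsB uw uz e0; have := uK K (leqnn _).
by rewrite subrr sub0r opprB.
Qed.

End PointwiseLimit.

(** * The closed Laplacian and its essential spectrum *)

Section Laplacian.
Variables (R : realType) (V : countType) (G : wdigraph R V) (m : V -> R).
Hypothesis m_gt0 : forall x, 0 < m x.
Hypothesis G_lf : locally_finite G.
Hypothesis beta_eq : forall x, beta_out G x = beta_in G x.
Local Notation b := (weight G).
Local Notation L := (op_app (laplacian m G)).
Local Notation Lbar := (operator_closure m (laplacian m G)).
Implicit Types (f g u v : V -> R[i]).

Lemma lapE f x (s : {fset V}) : {subset nbr G x <= s} ->
  L f x = ((m x)^-1)%:C * \sum_(y <- s) (b x y)%:C * (f x - f y).
Proof.
move=> xs; congr (_ * _); apply: fsbigTE => y /(contra (xs y)) /(nbr_out G_lf) ->.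
by rewrite mul0r.
Qed.

Lemma lap_linear a f g x :
  L (fun y => a * f y + g y) x = a * L f x + L g x.
Proof.
rewrite !(@lapE _ x (nbr G x)) // mulrCA -mulrDr; congr (_ * _).
rewrite mulr_sumr -big_split; apply: eq_bigr => y _ /=; ring.
Qed.

(** By local finiteness [L f x] is a finite combination of values of [f]. Hence l^2 limits of
    [L (u k)] are determined by the limit of [u]: this is closability, and the closure acts by the
    same formula. *)
Lemma lap_ptends (u : nat -> V -> R[i]) f x :
  (forall y, ptends (u^~ y) (f y)) -> ptends (fun k => L (u k) x) (L f x).
Proof.
move=> uf; rewrite (@lapE _ x (nbr G x)) //.
under [X in ptends X]funext do rewrite (@lapE _ x (nbr G x)) //.
apply: ptendsZ; apply: ptends_sum => y; apply: ptendsZ.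
exact: (ptendsB (uf x) (uf y)).
Qed.

Lemma Cc_lap f : Cc f -> Cc (L f).
Proof.
move=> fC; have [s sf] := cover_finite G fC.
have L0 x : x \notin s -> L f x = 0.
  move=> xs; have f0 y : x \in nbr G y \/ x = y -> f y = 0.
    move=> xy; apply/eqP; apply: contraNT xs => fy.
    by have [ys sy] := sf y fy; case: xy => [/sy|->].
  rewrite (@lapE _ x (nbr G x)) // big1_seq ?mulr0 // => y /= yx.
  by rewrite !f0 ?subrr ?mulr0 //; [left; rewrite mem_nbr|right].
apply: (sub_finite_set (B := [set` s])); last exact: finite_fset.
by move=> x; apply: contraTT => /L0 ->; rewrite negbK.
Qed.

Lemma CcD a f g : Cc f -> Cc g -> Cc (fun x => a * f x + g x).
Proof.
move=> fC gC.
apply: (sub_finite_set (B := [set x | f x != 0] `|` [set x | g x != 0])).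
  move=> x /=; have [->|fx] := eqVneq (f x) 0; last by left.
  by rewrite mulr0 add0r; right.
by rewrite finite_setU.
Qed.

Lemma Cc0 : Cc (fun=> 0 : R[i]) (V := V).
Proof. by apply: (sub_finite_set (B := set0)) => // x /=; rewrite eqxx. Qed.

Section Shifted.
Variable lam : R[i].

Definition shift_lap f (x : V) : R[i] := L f x - lam * f x.
Local Notation T := shift_lap.

Lemma shift_lap_linear a f g x :
  T (fun y => a * f y + g y) x = a * T f x + T g x.
Proof. by rewrite /T lap_linear; ring. Qed.

Lemma Cc_shift_lap f : Cc f -> Cc (T f).
Proof.
move=> fC; have := CcD (- lam) fC (Cc_lap fC); congr Cc.
by apply/funext => x; rewrite mulNr addrC.
Qed.

(* The domain of the closure, with approximations instead of sequences; the
   graph norms of the Laplacian and of its shifts are equivalent. *)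
Definition closure_dom : set (V -> R[i]) := [set f | forall e, 0 < e ->
  exists u, [/\ Cc u, l2le m (fun x => u x - f x) e &
                l2le m (fun x => T u x - T f x) e]].
Local Notation D := closure_dom.

Lemma closure_dom_subspace : subspace_set D.
Proof.
split=> [e e0|a f g Df Dg e e0].
  have z0 : l2le m (fun x : V => 0 : R[i]) e.
    by apply: l2le_trans (l2le0 m); exact: ltW.
  by exists (fun=> 0); split; [exact: Cc0|apply: eq_l2le z0 => x..]; rewrite subrr.
have a0 : 0 < sqn a + 1 by rewrite ltr_wpDl ?sqn_ge0.
have [|u [uC uf Tuf]] := Df (e / 4 / (sqn a + 1)).
  by rewrite !divr_gt0.
have [|v [vC vg Tvg]] := Dg (e / 4); first by rewrite divr_gt0.
have small : 2 * (sqn a * (e / 4 / (sqn a + 1))) + 2 * (e / 4) <= e.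
  have : sqn a * (e / 4 / (sqn a + 1)) <= e / 4.
    rewrite mulrCA ler_piMr ?divr_ge0 ?(ltW e0) // ler_pdivrMr // mul1r.
    by rewrite lerDl.
  lra.
exists (fun x => a * u x + v x); split; first exact: CcD.
  apply: l2le_trans small _; have := l2leD m_gt0 (l2leZ a uf) vg.
  by apply: eq_l2le => x; ring.
apply: l2le_trans small _; have := l2leD m_gt0 (l2leZ a Tuf) Tvg.
by apply: eq_l2le => x; rewrite !shift_lap_linear; ring.
Qed.

(** Pointwise limits identify [T f] with [g]; approximating a late [u k] by a finitely supported
    function also approximates [f]. *)
Lemma shift_lap_closed : closed_on m T D.
Proof.
move=> u f g Du uf Tug.
have Tf : T f =1 g.
  move=> x; apply: (@ptends_unique _ (fun k => T (u k) x)).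
    apply: ptendsB; last apply: ptendsZ.
      by apply: lap_ptends => y e; exact: l2cv_point.
    by move=> e; exact: (l2cv_point m_gt0 x uf).
  by move=> e; exact: (l2cv_point m_gt0 x Tug).
split=> // e e0; have e4 : 0 < e / 4 by rewrite divr_gt0.
have [K uK] := uf _ e4; have [K' TuK] := Tug _ e4.
set k := maxn K K'; have [v [vC vu Tvu]] := Du k _ e4.
have ee : 2 * (e / 4) + 2 * (e / 4) <= e by lra.
exists v; split=> //; apply: l2le_trans ee _.
  exact: l2leB vu (uK k (leq_maxl _ _)).
have := l2leB m_gt0 Tvu (TuK k (leq_maxr _ _)).
by apply: eq_l2le => x; rewrite Tf.
Qed.

(** Functions supported in [W] are combinations of point masses, each with a finitely supported
    image; the vertices are split off one by one. *)
Lemma shift_lap_finite_bound (W : seq V) : exists2 C, 0 <= C &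
  forall u r, 0 <= r -> (forall x, u x != 0 -> x \in W) ->
    (forall x, x \in W -> sqn (u x) <= r) -> l2le m (T u) (C * r).
Proof.
elim: W => [|w W [C C0 IH]].
  exists 0 => // u r _ u0 _; rewrite mul0r.
  have -> : u = fun=> 0.
    by apply/funext => x; apply/eqP/negPn/negP => /u0.
  apply: eq_l2le (l2le0 m) => x; apply/esym.
  exact: (linear_op0 shift_lap_linear).
pose d (x : V) : R[i] := (x == w)%:R.
have [c Td] : exists c, l2le m (T d) c.
  apply: (l2le_fin m_gt0); apply: Cc_shift_lap.
  apply: (sub_finite_set (B := [set w])) => // x /=.
  by rewrite /d; case: (eqVneq x w) => //; rewrite eqxx.
have c0 := l2le_ge0 Td.
exists (2 * c + 2 * C); first by rewrite addr_ge0 ?mulr_ge0.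
move=> u r r0 uW ur.
pose u' x := if x == w then 0 else u x.
have u'r : l2le m (T u') (C * r).
  apply: IH => // x; rewrite /u'; case: (eqVneq x w) => //= [|xw].
  - by rewrite eqxx.
  - by move=> /uW; rewrite inE (negPf xw).
  - by rewrite sqn0.
  - by move=> xW; apply: ur; rewrite inE xW orbT.
have := l2leD m_gt0 (l2leZ (u w) Td) u'r.
have uE x : T u x = u w * T d x + T u' x.
  rewrite -shift_lap_linear; congr (T _ x); apply/funext => y.
  by rewrite /d /u'; case: eqP => [->|_]; rewrite ?mulr1 ?addr0 ?mulr0 ?add0r.
move=> /(eq_l2le (fun x => esym (uE x))); apply: l2le_trans.
have : sqn (u w) * c <= r * c by rewrite ler_wpM2r // ur // mem_head.
lra.
Qed.

Definition coercive_off (W : seq V) (d : R) := forall f r, Cc f ->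
  (forall x, x \in W -> f x = 0) -> l2le m (T f) r -> l2le m f (d * r).

(** Split [u] into its restriction [u1] to [W] and the rest. The first part is bounded by the values
    on [W]; the second vanishes on [W], and its image [T u - T u1] is bounded since [T] is bounded
    on functions supported in [W]. *)
Lemma coercive_apriori_Cc W d : 0 <= d -> coercive_off W d ->
  exists2 C, 0 < C & apriori m T (@Cc R V) W C.
Proof.
move=> d0 dW; have [C C0 CW] := shift_lap_finite_bound W.
pose mW := \sum_(x <- undup W) m x.
have mW0 : 0 <= mW by apply: sumr_ge0 => x _; exact: ltW.
(* The first two terms come from [u1] and [u - u1]; the 1 ensures positivity. *)
exists (2 * mW + 2 * (d * (2 + 2 * C)) + 1).
  by rewrite ltr_wpDl // !addr_ge0 ?mulr_ge0 ?addr_ge0 // mulr_ge0.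
move=> u r uC Tur uW; have r0 := l2le_ge0 Tur.
pose u1 x := if x \in W then u x else 0.
have u1W x : u1 x != 0 -> x \in W.
  by rewrite /u1; case: ifP => //; rewrite eqxx.
have u1r : l2le m u1 (mW * r).
  apply: (l2le_supp m_gt0 (undup_uniq W)).
    by move=> x /u1W; rewrite mem_undup.
  rewrite mulr_suml big_seq [leRHS]big_seq; apply: ler_sum => x.
  rewrite mem_undup => xW; rewrite ler_wpM2l ?(ltW (m_gt0 x)) //.
  by rewrite /u1 xW uW.
have Tu1 : l2le m (T u1) (C * r).
  by apply: CW => // x xW; rewrite /u1 xW uW.
have u1C : Cc u1.
  by apply: (sub_finite_set (B := [set` W])); [move=> x /u1W|exact: finite_seq].
have u2r : l2le m (fun x => u x - u1 x) (d * (2 * r + 2 * (C * r))).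
  apply: dW.
  - have := CcD (-1) u1C uC; congr Cc.
    by apply/funext => x; rewrite mulN1r addrC.
  - by move=> x xW; rewrite /u1 xW subrr.
  have Tu1' : l2le m (fun x => - T u1 x) (C * r).
    by move=> s us; under eq_bigr do rewrite sqnN; exact: Tu1.
  have := l2leD m_gt0 Tur Tu1'; apply: eq_l2le => x.
  by rewrite (linear_opB shift_lap_linear).
have := l2leD m_gt0 u1r u2r.
move=> /(@eq_l2le _ _ _ _ u) ur; apply: l2le_trans (ur _); last first.
  by move=> x; rewrite addrC subrK.
lra.
Qed.

(** The estimate passes from finitely supported approximants to the closure, as l^2 closeness
    controls the values on the finite set [W]. *)
Lemma coercive_apriori W d : 0 <= d -> coercive_off W d ->
  exists2 C, 0 < C & apriori m T D W C.
Proof.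
move=> d0 /(coercive_apriori_Cc d0) [C C0 CW].
exists (4 * C); first by rewrite mulr_gt0.
move=> f r Df Tfr fW s us; have r0 := l2le_ge0 Tfr.
pose mW := \sum_(x <- undup W) (m x)^-1.
have mW0 : 0 <= mW by apply: sumr_ge0 => x _; rewrite invr_ge0 ltW.
have mWx x : x \in W -> (m x)^-1 <= mW.
  rewrite -mem_undup => xW; rewrite /mW (bigD1_seq x xW (undup_uniq W)) /=.
  by rewrite lerDl sumr_ge0 // => y _; rewrite invr_ge0 ltW.
(* With precision [e'] the final bound is [4 * C * r + e' * k], so [e' = e / k] is the right choice;
   the 4 results from passing from [f] to [u] and back. *)
pose k := 2 + 4 * C * (1 + mW).
have k0 : 0 < k by rewrite ltr_wpDr // !mulr_ge0 // ?addr_ge0 // ltW.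
apply/ler_addgt0Pl => e e0; pose e' := e / k.
have e'0 : 0 < e' by rewrite divr_gt0.
have [u [uC uf Tuf]] := Df _ e'0.
have Tu : l2le m (T u) (2 * e' + 2 * r).
  by have := l2leD m_gt0 Tuf Tfr; apply: eq_l2le => x; rewrite subrK.
have ur : l2le m u (C * (2 * r + 2 * e' * (1 + mW))).
  apply: CW => // [|x xW].
    apply: l2le_trans Tu; have := mulr_ge0 (ltW e'0) mW0; lra.
  have := sqnD (u x - f x) (f x); rewrite subrK => /le_trans; apply.
  have := l2le_point m_gt0 x uf; have := fW x xW.
  have := ler_wpM2r (ltW e'0) (mWx x xW); lra.
have := l2leD m_gt0 (l2leN uf) ur => /(_ s us).
under eq_bigr do rewrite subrK.
move=> /le_trans; apply.
have -> : e = e' * k by rewrite divfK // gt_eqF.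
rewrite /k; lra.
Qed.

Lemma closureP f : op_dom Lbar f <-> D f.
Proof.
split=> [[g [_ _ [u [uC /(l2cvgP m_gt0) uf /(l2cvgP m_gt0) ug]]]] e e0 | Df].
  have gE x : g x = L f x.
    apply: (@ptends_unique _ (fun k => L (u k) x)).
      by move=> d; exact: (l2cv_point m_gt0 x ug).
    by apply: lap_ptends => y d; exact: l2cv_point.
  have l0 : 0 < 2 + 2 * sqn lam by rewrite ltr_wpDr ?mulr_ge0 ?sqn_ge0.
  have e'0 : 0 < e / (2 + 2 * sqn lam) by rewrite divr_gt0.
  have [K uK] := uf _ e'0; have [K' uK'] := ug _ e'0; have [K2 uK2] := uf _ e0.
  set k := maxn (maxn K K') K2.
  have kK : (K <= k)%N by rewrite /k !leq_max leqnn.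
  have kK' : (K' <= k)%N by rewrite /k !leq_max leqnn orbT.
  exists (u k); split; [exact: uC|exact/uK2/leq_maxr|].
  have := l2leD m_gt0 (uK' k kK') (l2leZ (- lam) (uK k kK)).
  rewrite sqnN => /(@eq_l2le _ _ _ _ (fun x => T (u k) x - T f x)) Tu.
  apply: l2le_trans (Tu _); last by move=> x; rewrite /T gE; ring.
  have -> : 2 * (e / (2 + 2 * sqn lam)) + 2 * (sqn lam * (e / (2 + 2 * sqn lam))) =
    (e / (2 + 2 * sqn lam)) * (2 + 2 * sqn lam) by ring.
  by rewrite divfK // gt_eqF.
have /choice[u uP] : forall k : nat, exists v, [/\ Cc v,
    l2le m (fun x => v x - f x) (1 / k.+1%:R) &
    l2le m (fun x => T v x - T f x) (1 / k.+1%:R)].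
  by move=> k; apply: Df; rewrite divr_gt0.
have Tuf k : l2le m (fun x => L (u k) x - L f x)
    ((2 + 2 * sqn lam) / k.+1%:R).
  case: (uP k) => _ uf Tuf; have := l2leD m_gt0 Tuf (l2leZ lam uf).
  move=> /(@eq_l2le _ _ _ _ (fun x => L (u k) x - L f x)) Lu.
  apply: l2le_trans (Lu _); last by move=> x; rewrite /T; ring.
  set j := k.+1%:R^-1; lra.
have l0 : 0 <= 2 + 2 * sqn lam by rewrite addr_ge0 ?mulr_ge0 ?sqn_ge0.
exists (L f); split.
- apply/(l2P m_gt0); case: (uP 0%N) => u0C u0 _.
  have [r u0r] := l2le_fin m_gt0 u0C; exists (2 * (1 / 1) + 2 * r).
  by have := l2leD m_gt0 (l2leN u0) u0r; apply: eq_l2le => x; rewrite subrK.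
- apply/(l2P m_gt0); case: (uP 0%N) => u0C _ _.
  have [r u0r] := l2le_fin m_gt0 (Cc_lap u0C).
  exists (2 * ((2 + 2 * sqn lam) / 1) + 2 * r).
  by have := l2leD m_gt0 (l2leN (Tuf 0%N)) u0r; apply: eq_l2le => x; rewrite subrK.
exists u; split; first by move=> k; case: (uP k).
  apply/(l2cvgP m_gt0) => e e0; have [K eK] := inv_small ler01 e0.
  by exists K => k /eK ek; apply: l2le_trans ek _; case: (uP k).
apply/(l2cvgP m_gt0) => e e0; have [K eK] := inv_small l0 e0.
by exists K => k /eK ek; apply: l2le_trans ek _; exact: Tuf.
Qed.

(** Whichever limit [xget] selects, it is the pointwise limit of the [L (u k)], that is [L f]. *)
Lemma closure_appE f : op_dom Lbar f -> op_app Lbar f =1 L f.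
Proof.
move=> fD; rewrite /=; move: (xgetPex (fun=> 0) fD) => /=.
set g := xget _ _ => -[_ _ [u [_ /(l2cvgP m_gt0) uf /(l2cvgP m_gt0) ug]]] x.
apply: (@ptends_unique _ (fun k => L (u k) x)).
  by move=> d; exact: (l2cv_point m_gt0 x ug).
by apply: lap_ptends => y d; exact: l2cv_point.
Qed.

Lemma coercive_not_ess W d : 0 <= d -> coercive_off W d ->
  ~ ess_spectrum m Lbar lam.
Proof.
move=> d0 /(coercive_apriori d0) [C C0 CW] [|infd]; last first.
  apply: (apriori_finite_kernel m_gt0 shift_lap_linear CW closure_dom_subspace).
  move=> n; have [f [fK ind]] := infd n; exists f; split=> // i.
  have [fD f0] := fK i; split; first exact/closureP.
  by move=> x; rewrite /T -(closure_appE fD).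
apply => g _ gapp.
have [e e0|f Df Tf] := apriori_closed_range m_gt0 shift_lap_linear
    closure_dom_subspace shift_lap_closed C0 CW (g := g).
  have [|_ [f fD <-] fg] := gapp (Num.sqrt e); first by rewrite sqrtr_gt0.
  exists f; first exact/closureP.
  have := l2norm_lt_l2le m_gt0 fg; rewrite sqr_sqrtr ?(ltW e0) //.
  by apply: eq_l2le => x; rewrite (closure_appE fD).
have fD : op_dom Lbar f by exact/closureP.
by exists f => //; apply/funext => x; rewrite (closure_appE fD) -Tf.
Qed.

(** The real part of z times the conjugate of w. *)
Definition dotr (z w : R[i]) : R :=
  complex.Re z * complex.Re w + complex.Im z * complex.Im w.

(** With d = c - Re lam, the hypothesis gives d |f|^2 <= Re(T f, f) for [f] vanishing on [W], whence
    d |f| <= |T f|. *)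
Lemma form_coercive W c : complex.Re lam < c ->
    (forall f, Cc f -> (forall x, x \in W -> f x = 0) ->
      exists s : seq V, [/\ uniq s, forall x, f x != 0 -> x \in s &
        c * \sum_(x <- s) m x * sqn (f x) <=
          \sum_(x <- s) m x * dotr (L f x) (f x)]) ->
  coercive_off W ((c - complex.Re lam) ^- 2).
Proof.
move=> lc form f r fC fW Tfr; have [s [us sf cs]] := form f fC fW.
set d := c - complex.Re lam; have d0 : 0 < d by rewrite subr_gt0.
apply: (l2le_supp m_gt0 us sf); rewrite ler_pdivlMl ?exprn_gt0 //.
apply: le_trans (Tfr s us).
(* Young's inequality for Re(T f, f) with parameter [d]; the two sides differ by a positive multiple
   of |T f - d f|^2. *)
have : \sum_(x <- s) m x * dotr (L f x) (f x) <= \sum_(x <- s)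
    ((complex.Re lam + d / 2) * (m x * sqn (f x)) +
     d^-1 / 2 * (m x * sqn (T f x))).
  apply: ler_sum => x _; rewrite -subr_ge0.
  have -> : (complex.Re lam + d / 2) * (m x * sqn (f x)) +
     d^-1 / 2 * (m x * sqn (T f x)) - m x * dotr (L f x) (f x) =
     m x * ((complex.Re lam + d / 2) * sqn (f x) +
       d^-1 / 2 * sqn (T f x) - dotr (L f x) (f x)) by ring.
  rewrite mulr_ge0 ?(ltW (m_gt0 x)) // /T.
  clearbody d; case: (L f x) (f x) (lam) => [a1 a2] [b1 b2] [l1 l2].
  rewrite /dotr /sqn /=.
  set p := a1 - (l1 * b1 - l2 * b2); set q := a2 - (l1 * b2 + l2 * b1).
  have -> : (l1 + d / 2) * (b1 ^+ 2 + b2 ^+ 2) + d^-1 / 2 * (p ^+ 2 + q ^+ 2) -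
    (a1 * b1 + a2 * b2) = d^-1 / 2 * ((p - d * b1) ^+ 2 + (q - d * b2) ^+ 2).
    by rewrite /p /q; field; rewrite gt_eqF.
  by rewrite mulr_ge0 ?addr_ge0 ?sqr_ge0 // divr_ge0 // invr_ge0 ltW.
rewrite big_split /= -!mulr_sumr.
set S := \sum_(x <- s) m x * sqn (f x) in cs *.
set S' := \sum_(x <- s) m x * sqn (T f x) => SS'.
have : d * (c * S) <= d * ((complex.Re lam + d / 2) * S + d^-1 / 2 * S').
  by rewrite ler_pM2l // (le_trans cs).
have -> : d * ((complex.Re lam + d / 2) * S + d^-1 / 2 * S') =
  d * (complex.Re lam + d / 2) * S + S' / 2 by field; rewrite gt_eqF.
have -> : c = d + complex.Re lam by rewrite subrK.
lra.
Qed.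

End Shifted.

(** The measure cancels and real weights do not mix real and imaginary parts, so the form reduces to
    the real case of [cheeger_form]. *)
Lemma lap_form f (s : {fset V}) : covers G s [set x | f x != 0] ->
  \sum_(x <- s) m x * dotr (L f x) (f x) =
  wsum G s (fun x y => (complex.Re (f x) - complex.Re (f y)) * complex.Re (f x)) +
  wsum G s (fun x y => (complex.Im (f x) - complex.Im (f y)) * complex.Im (f x)).
Proof.
move=> sf; rewrite -wsumD; apply: eq_bigr => x _.
have [fx|fx] := eqVneq (f x) 0.
  rewrite /dotr fx /= !mulr0 addr0 mulr0 big1 // => y _.
  by rewrite !mulr0 addr0 mulr0.
have [_ sx] := sf x fx; rewrite (lapE _ sx).
have mxn : m x != 0 by rewrite gt_eqF.
set A := \sum_(y <- s) _.
have -> : m x * dotr (((m x)^-1)%:C * A) (f x) = dotr A (f x).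
  case: A (f x) => [a1 a2] [b1 b2]; rewrite /dotr /=.
  by field.
rewrite {}/A; elim: (s : seq V) => [|y t IH].
  by rewrite !big_nil /dotr /= !mul0r addr0.
rewrite !big_cons -IH; set A := \sum_(j <- t) _.
case: A (f x) (f y) => [a1 a2] [b1 b2] [c1 c2]; rewrite /dotr /=; ring.
Qed.

(** Cheeger's inequality on the real and imaginary parts bounds the form below by the left-hand
    side, off [W]; a smaller Re lam would make the shifted operator coercive there. The number [a]
    converts the [mu]-norm into the [m]-norm. *)
Lemma ess_cheeger_le (mu : V -> R) (h M a : R) (W : set V) lam :
    finite_set W ->
    (forall U, finite_parts (~` W) U ->
       h * (\sum_(x \in U) mu x) <= weight_boundary G U) ->
    0 <= h -> 0 < M ->
    (forall x, ~ W x -> beta_out G x <= M * mu x) ->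
    (forall x, ~ W x -> a * m x <= mu x) ->
    ess_spectrum m Lbar lam ->
  a * h ^+ 2 / (8 * M) <= complex.Re lam.
Proof.
move=> /finite_seqP[w ->] hU h0 M0 bM am lam_ess; rewrite leNgt; apply/negP => lamc.
have M8 : 0 < 8 * M by rewrite mulr_gt0.
apply: (coercive_not_ess _ (form_coercive (W := w) lamc _) lam_ess).
  by rewrite invr_ge0 sqr_ge0.
move=> f fC fw; have [s sf] := cover_finite G fC.
exists s; split; first exact: fset_uniq.
  by move=> x /sf[].
have supp x : f x != 0 -> ~ [set` w] x.
  by move=> fx /= xw; rewrite fw ?eqxx in fx.
rewrite (lap_form sf) mulrAC ler_pdivrMr // [leRHS]mulrC mulrDr.
have sRe : covers G s [set x | complex.Re (f x) != 0].
  by move=> x /= fx; apply: sf; apply: contraNneq fx => /= ->.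
have sIm : covers G s [set x | complex.Im (f x) != 0].
  by move=> x /= fx; apply: sf; apply: contraNneq fx => /= ->.
apply: le_trans (lerD (cheeger_form G_lf beta_eq hU h0 M0 bM sRe _)
                      (cheeger_form G_lf beta_eq hU h0 M0 bM sIm _)) => //.
- rewrite -mulrDr -big_split /= mulrAC mulrC ler_wpM2l ?sqr_ge0 //.
  rewrite mulr_sumr; apply: ler_sum => x _; rewrite -mulrDr mulrA.
  have [fx|fx] := eqVneq (f x) 0; first by rewrite fx sqn0 /= expr0n addr0 !mulr0.
  by rewrite ler_wpM2r ?sqn_ge0 // am //; exact: supp.
- by move=> x /= fx; apply: supp; apply: contraNneq fx => /= ->.
- by move=> x /= fx; apply: supp; apply: contraNneq fx => /= ->.
Qed.

End Laplacian.

(** * Elementary properties of the Cheeger constants *)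

Section CheegerConstant.
Variables (R : realType) (V : countType) (G : wdigraph R V).
Implicit Types (mu : V -> R) (Om : set V).

Lemma weight_boundary_ge0 U : 0 <= weight_boundary G U.
Proof. by apply: sumr_ge0 => e _; exact: weight_ge0. Qed.

Lemma fsum_gt0 mu U : (forall x, 0 < mu x) -> finite_set U -> U !=set0 ->
  0 < \sum_(x \in U) mu x.
Proof.
move=> mu0 finU [x Ux]; rewrite fsbig_finite //=.
rewrite (bigD1_seq x) ?fset_uniq //= ?in_fset_set // ?mem_set //.
by rewrite ltr_pwDl // sumr_ge0 // => y _; exact: ltW.
Qed.

Lemma cheeger_subset mu A B : A `<=` B -> (cheeger G mu B <= cheeger G mu A)%E.
Proof.
move=> AB; apply: le_ereal_inf_tmp => _ [U [finU U0 UA] <-].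
apply: ereal_inf_lbound; exists U => //; split=> //.
exact: subset_trans AB.
Qed.

Lemma cheeger_ge0 mu Om : (forall x, 0 < mu x) -> (0 <= cheeger G mu Om)%E.
Proof.
move=> mu0; apply: le_ereal_inf_tmp => _ [U [finU U0 UA] <-].
by rewrite lee_fin divr_ge0 ?weight_boundary_ge0 // ltW // fsum_gt0.
Qed.

Lemma cheeger_isoperimetric mu Om t U : (forall x, 0 < mu x) ->
  (t%:E <= cheeger G mu Om)%E -> finite_parts Om U ->
  t * (\sum_(x \in U) mu x) <= weight_boundary G U.
Proof.
move=> mu0 tOm UO; have [finU U0 _] := UO.
rewrite -ler_pdivlMr ?fsum_gt0 // -lee_fin; apply: le_trans tOm _.
by apply: ereal_inf_lbound; exists U.
Qed.

Lemma cheeger_le1 mu Om x : locally_finite G ->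
  (forall x, beta_out G x = beta_in G x) -> (forall x, 0 < mu x) -> Om x ->
  (cheeger G mu Om <= (2 * (beta_out G x / mu x))%:E)%E.
Proof.
move=> lf bb mu0 Ox.
apply: (@le_trans _ _ (weight_boundary G [set x] / \sum_(y \in [set x]) mu y)%:E).
  apply: ereal_inf_lbound; exists [set x] => //; split.
  - exact: finite_set1.
  - by exists x.
  - by move=> y ->.
rewrite lee_fin fsbig_set1 mulrA ler_wpM2r ?invr_ge0 ?(ltW (mu0 x)) //.
exact: weight_boundary1_le.
Qed.

End CheegerConstant.

(** * Monotone limits and passage to infinity along the filtration *)

Lemma limn_nondecreasing (R : realType) (u : (\bar R)^nat) :
  (forall n, u n <= u n.+1)%E -> limn u = ereal_sup (range u).
Proof.
by move=> /nondecreasing_seqP /ereal_nondecreasing_cvgn/cvg_lim; apply.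
Qed.

Lemma limn_nonincreasing (R : realType) (u : (\bar R)^nat) :
  (forall n, u n.+1 <= u n)%E -> limn u = ereal_inf (range u).
Proof.
by move=> /nonincreasing_seqP /ereal_nonincreasing_cvgn/cvg_lim; apply.
Qed.

(** Let x tend to 1, using (1 - d)^3 >= 1 - 3 d. The cube arises from relaxing h by a factor x,
    which is squared, and M or m by one more. *)
Lemma le_cube_lim (R : realFieldType) (k r : R) : 0 <= k ->
  (forall x, 0 < x -> x < 1 -> k * x ^+ 3 <= r) -> k <= r.
Proof.
move=> k0 kr; apply/ler_addgt0Pl => e e0.
pose d := e / (3 * (e + k + 1)).
have den : 0 < 3 * (e + k + 1) by lra.
have d0 : 0 < d by rewrite divr_gt0.
have d1 : d < 1 by rewrite ltr_pdivrMr //; lra.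
have kd : 3 * (k * d) <= e.
  have : d * (3 * (e + k + 1)) = e by rewrite divfK // gt_eqF.
  by have := mulr_gt0 d0 e0; lra.
have := kr (1 - d); rewrite subr_gt0 gtrBl => /(_ d1 d0).
have : 1 - 3 * d <= (1 - d) ^+ 3.
  have -> : (1 - d) ^+ 3 = 1 - 3 * d + d ^+ 2 * (3 - d) by ring.
  by rewrite lerDl mulr_ge0 ?sqr_ge0 //; lra.
move=> /(ler_wpM2l k0); lra.
Qed.

Local Open Scope ereal_scope.

Theorem theorem3p2 (R : realType) (V : countType) (G : wdigraph R V)
    (m : V -> R) (Vn : nat -> set V)
    (V_infinite : infinite_set [set: V])
    (m_gt0 : forall x, (0 < m x)%R)
    (G_locally_finite : locally_finite G)
    (beta_out_gt0 : forall x, (0 < beta_out G x)%R)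
    (beta_in_gt0 : forall x, (0 < beta_in G x)%R)
    (assumption_beta : forall x, beta_out G x = beta_in G x)
    (G_connected : connected_graph G)
    (Vn_filtration : filtration G Vn) :
  let eta := eta_ess m (operator_closure m (laplacian m G)) in
  h_infty G m Vn ^+ 2 / 8%:E <=
    (if M_infty G m Vn == +oo then +oo else M_infty G m Vn * eta)
  /\ m_infty G m Vn * (h_tilde_infty G Vn ^+ 2 / 8%:E) <= eta.
Proof.
move=> eta; have [Vfin _ Vsub _] := Vn_filtration.
have subC n : ~` Vn n.+1 `<=` ~` Vn n by apply: subsetC; exact: Vsub.
(* Infinitely many vertices: no complement is empty, so suprema and infima over complements are not
   those of the empty set. *)
have Cex n : exists x, ~ Vn n x.
  apply: contra_notP V_infinite => allV.
  apply: sub_finite_set (Vfin n) => x _.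
  by apply: contrapT => nx; apply: allV; exists x.
have ess_ge lam a h M mu n : (forall x, 0 < mu x)%R -> (0 <= h)%R -> (0 < M)%R ->
    h%:E <= cheeger G mu (~` Vn n) ->
    (forall x, ~ Vn n x -> beta_out G x <= M * mu x)%R ->
    (forall x, ~ Vn n x -> a * m x <= mu x)%R ->
    ess_spectrum m (operator_closure m (laplacian m G)) lam ->
    (a * h ^+ 2 / (8 * M) <= complex.Re lam)%R.
  move=> mu0 h0 M0 hn bM am.
  apply: (ess_cheeger_le (W := Vn n) m_gt0 G_locally_finite assumption_beta
    _ _ h0 M0 bM am) => // U.
  exact: (cheeger_isoperimetric mu0 hn).
have hE mu : limn (fun n => cheeger G mu (~` Vn n)) =
    ereal_sup (range (fun n => cheeger G mu (~` Vn n))).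
  by apply: limn_nondecreasing => n; exact: cheeger_subset.
have h_mono mu : {homo (fun n => cheeger G mu (~` Vn n)) :
    k n / (k <= n)%N >-> k <= n}.
  by apply/nondecreasing_seqP => n; exact: cheeger_subset.
have h_ge0 mu : (forall x, 0 < mu x)%R ->
    0 <= limn (fun n => cheeger G mu (~` Vn n)).
  move=> mu0; rewrite hE; apply: le_trans (cheeger_ge0 G (~` Vn 0%N) mu0) _.
  by apply: ereal_sup_ubound; exists 0%N.
(* The case [a = 0], [h = 0] of [ess_ge]; it settles the cases where a Cheeger constant vanishes. *)
have lam_ge0 lam : ess_spectrum m (operator_closure m (laplacian m G)) lam ->
    (0 <= complex.Re lam)%R.
  have := ess_ge lam 0%R 0%R 1%R (beta_out G) 0%N beta_out_gt0 (lexx _) ltr01.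
  rewrite !mul0r; apply; first exact: cheeger_ge0.
  - by move=> x _; rewrite mul1r.
  - by move=> x _; rewrite mul0r ltW.
split.
  have MS n : M_sup G m (~` Vn n.+1) <= M_sup G m (~` Vn n).
    apply: ge_ereal_sup => _ [x nx <-]; apply: ereal_sup_ubound.
    by exists x => //; exact: subC.
  have M_mono : {homo (fun n => M_sup G m (~` Vn n)) :
      k n / (k <= n)%N >-> n <= k} by apply/nonincreasing_seqP.
  have ME : M_infty G m Vn = ereal_inf (range (fun n => M_sup G m (~` Vn n))).
    exact: limn_nonincreasing.
  have M_ge0 : 0 <= M_infty G m Vn.
    rewrite ME; apply: le_ereal_inf_tmp => _ [n _ <-].
    have [x nx] := Cex n.
    apply: (@le_trans _ _ (beta_out G x / m x)%:E).
      by rewrite lee_fin divr_ge0 // ltW.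
    by apply: ereal_sup_ubound; exists x.
  (* Testing with single vertices; thus [h_infty] is finite when [M_infty] is, and 0 when [M_infty]
     is 0. *)
  have h2M : h_infty G m Vn <= 2%:E * M_infty G m Vn.
    rewrite /h_infty hE; apply: ge_ereal_sup => _ [k _ <-].
    rewrite -lee_pdivrMl // ME; apply: le_ereal_inf_tmp => _ [n _ <-].
    rewrite lee_pdivrMl //; set l := maxn k n.
    apply: le_trans (h_mono m _ _ (leq_maxl k n)) _.
    have [x nx] := Cex l; apply: le_trans (cheeger_le1 _ _ m_gt0 nx) _ => //.
    rewrite EFinM lee_pmul2l //; apply: le_trans (M_mono _ _ (leq_maxr k n)).
    by apply: ereal_sup_ubound; exists x.
  case: eqP => [_|]; first exact: leey.
  move: M_ge0 h2M (h_ge0 m m_gt0); rewrite -/(h_infty G m Vn).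
  case EM : (M_infty G m Vn) => [B||] //; rewrite lee_fin => B0.
  case Eh : (h_infty G m Vn) => [H||] //; rewrite -EFinM !lee_fin => HB H0 _.
  rewrite -EFin_expe inver pnatr_eq0 /= -EFinM.
  (* Here the right-hand side is 0 even if [eta] is [+oo]. *)
  have [B00|Bn0] := eqVneq B 0%R.
    have -> : H = 0%R.
      by apply/eqP; rewrite eq_le H0 andbT; move: HB; rewrite B00 mulr0.
    by rewrite expr0n mul0r B00 mul0e.
  have Bgt0 : (0 < B)%R by rewrite lt0r Bn0.
  rewrite -lee_pdivrMl // -EFinM; apply: le_ereal_inf_tmp => _ [lam lam_ess <-].
  rewrite lee_fin; apply: le_cube_lim => [|x x0 x1].
    by rewrite mulr_ge0 ?divr_ge0 ?invr_ge0 ?sqr_ge0.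
  have [Hz|Hn0] := eqVneq H 0%R.
    by rewrite Hz expr0n !mul0r mulr0 mul0r; exact: lam_ge0.
  have Hgt0 : (0 < H)%R by rewrite lt0r Hn0.
  (* The relaxed values [H * x] and [B / x] are already bounds at finite stages [k] and [n]; both
     hold at [maxn k n]. *)
  have : (H * x)%:E < h_infty G m Vn by rewrite Eh lte_fin gtr_pMr.
  rewrite /h_infty hE => /ereal_sup_gt[_ [k _ <-]] /ltW hk.
  have : M_infty G m Vn < (B / x)%:E.
    by rewrite EM lte_fin ltr_pdivlMr // gtr_pMr.
  rewrite ME => /ereal_inf_lt[_ [n _ <-]] /ltW Mn.
  have := ess_ge lam 1%R (H * x)%R (B / x)%R m (maxn k n) m_gt0.
  rewrite mulr_ge0 ?(ltW x0) // divr_gt0 // => /(_ isT isT) lamb.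
  apply: le_trans (lamb _ _ _ lam_ess).
  - rewrite le_eqVlt; apply/orP; left; apply/eqP; field.
    by rewrite Bn0 gt_eqF.
  - exact: le_trans hk (h_mono m _ _ (leq_maxl _ _)).
  - move=> y ny; rewrite -ler_pdivrMr // -lee_fin.
    apply: le_trans Mn; apply: le_trans (M_mono _ _ (leq_maxr k n)).
    by apply: ereal_sup_ubound; exists y.
  - by move=> y _; rewrite mul1r.
have mS n : m_inf G m (~` Vn n) <= m_inf G m (~` Vn n.+1).
  apply: le_ereal_inf_tmp => _ [x nx <-]; apply: ereal_inf_lbound.
  by exists x => //; exact: subC.
have m_mono : {homo (fun n => m_inf G m (~` Vn n)) :
    k n / (k <= n)%N >-> k <= n} by apply/nondecreasing_seqP.
have mE : m_infty G m Vn = ereal_sup (range (fun n => m_inf G m (~` Vn n))).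
  exact: limn_nondecreasing.
have m_ge0 : 0 <= m_infty G m Vn.
  rewrite mE; apply: (@le_trans _ _ (m_inf G m (~` Vn 0%N))); last first.
    by apply: ereal_sup_ubound; exists 0%N.
  apply: le_ereal_inf_tmp => _ [x _ <-].
  by rewrite lee_fin divr_ge0 // ltW.
(* [cheeger_tilde] is [cheeger] for the measure beta^+, by conversion. *)
have htE : h_tilde_infty G Vn = limn (fun n => cheeger G (beta_out G) (~` Vn n)).
  by [].
have h_le2 : h_tilde_infty G Vn <= 2%:E.
  rewrite htE hE; apply: ge_ereal_sup => _ [n _ <-]; have [x nx] := Cex n.
  apply: le_trans (cheeger_le1 _ _ beta_out_gt0 nx) _ => //.
  by rewrite divff ?mulr1 // gt_eqF.
have := h_ge0 _ beta_out_gt0; rewrite -htE; move: h_le2.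
case Eh : (h_tilde_infty G Vn) => [H||] //; rewrite !lee_fin => _ H0.
rewrite -EFin_expe inver pnatr_eq0 /= -EFinM.
apply: le_ereal_inf_tmp => _ [lam lam_ess <-]; have lam0 := lam_ge0 _ lam_ess.
(* The product is 0 here, also when [m_infty] is [+oo]. *)
have [->|Hn0] := eqVneq H 0%R; first by rewrite expr0n mul0r mule0 lee_fin.
have Hgt0 : (0 < H)%R by rewrite lt0r Hn0.
have key a t : (0 <= t)%R -> a%:E < m_infty G m Vn -> (t < H)%R ->
    (a * t ^+ 2 / 8 <= complex.Re lam)%R.
  rewrite mE => t0 /ereal_sup_gt[_ [k _ <-]] /ltW mk.
  rewrite -lte_fin -Eh htE hE => /ereal_sup_gt[_ [n _ <-]] /ltW hn.
  have := ess_ge lam a t 1%R (beta_out G) (maxn k n) beta_out_gt0 t0 ltr01.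
  rewrite mulr1; apply=> //.
  - exact: le_trans hn (h_mono _ _ _ (leq_maxr _ _)).
  - by move=> x _; rewrite mul1r.
  - move=> x nx; rewrite -ler_pdivlMr // -lee_fin.
    apply: le_trans mk _; apply: le_trans (m_mono _ _ (leq_maxl k n)) _.
    by apply: ereal_inf_lbound; exists x.
move: m_ge0 key; case: (m_infty G m Vn) => [A||] //; rewrite ?lee_fin => A0 key.
  apply: le_cube_lim => [|x x0 x1].
    by rewrite mulr_ge0 ?divr_ge0 ?sqr_ge0.
  have [Az|An0] := eqVneq A 0%R; first by rewrite Az !mul0r.
  have Agt0 : (0 < A)%R by rewrite lt0r An0.
  have := key (A * x)%R (H * x)%R.
  rewrite lte_fin !gtr_pMr // mulr_ge0 ?(ltW x0) // => /(_ isT x1 x1).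
  by apply: le_trans; rewrite le_eqVlt; apply/orP; left; apply/eqP; field.
(* Now [m_infty] is [+oo] and [H > 0], so the essential spectrum must be empty: the chosen [a] would
   give Re lam + 1 <= Re lam. *)
exfalso.
have := key (8 * (complex.Re lam + 1) / (H / 2) ^+ 2)%R (H / 2)%R.
rewrite divr_ge0 // ltry => /(_ isT isT).
have -> : (8 * (complex.Re lam + 1) / (H / 2) ^+ 2 * (H / 2) ^+ 2 / 8 =
   complex.Re lam + 1)%R by field.
by rewrite ltr_pdivrMr // ltr_pMr // ltr1n => /(_ isT); rewrite gerDl ler10.
Qed.
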